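(* Let $(\Omega,\mathcal H,\mathcal E)$ be a convex expectation space and let $(\xi_n)_{n\in\mathbb N}\subset\mathcal H^d$ be an iid sequence of random vectors $\xi_n\colon\Omega\to\mathbb R^d$ with $\lim_{c\to\infty}\mathcal E[(|\xi_1|-c)^+]=0$. Suppose that $\mathcal E[c|\xi_1|^2]<\infty$ for all $c\ge 0$. Write $$\mathcal E[f(\zeta)]:=\sup_{y\in\mathbb R^d}\big(f(y)-\varphi(y)\big),\qquad\varphi(y):=\sup_{z\in\mathbb R^d}\big(\langle y,z\rangle-\mathcal E[\langle z,\xi_1\rangle]\big),\qquad f\in C_b .$$ Then, for all $r\ge 1$, $f\in\mathrm{Lip}_b(r)$ and $n\in\mathbb N$, $$-\frac{c_r^-}{\sqrt n}\le\frac1n\mathcal E\Big[nf\Big(\frac1n\sum_{i=1}^n\xi_i\Big)\Big]-\mathcal E[f(\zeta)]\le\frac{c_r^+}{\sqrt n},$$ where, with $c_r:=2r+\mathcal E[d^{1/2}r|\xi_1|]$, $$\begin{aligned}c_r^-&:=8r+5\,\mathcal E[d^{1/2}r|\xi_1|]+\mathcal E\big[\tfrac12drb_{0,1}|\xi_1|^2+d^{1/2}r|\xi_1|\big]+\mathcal E\big[(d^{1/2}(c_r+r)b_{1,1}+d^{1/2}r)|\xi_1|\big]+\tfrac12(c_r+r)b_{2,0},\\ c_r^+&:=8r+5\,\mathcal E[d^{1/2}r|\xi_1|]+\mathcal E\big[\tfrac12drb_{0,1}|\xi_1|^2+d^{1/2}r|\xi_1|\big]+\mathcal E\big[(d^{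1/2}(2c_r+r)b_{1,1}+d^{1/2}r)|\xi_1|\big]+\tfrac12(2c_r+r)b_{2,0}.\end{aligned}$$
   Context: A convex expectation space $(\Omega,\mathcal H,\mathcal E)$ consists of a set $\Omega$, a linear space $\mathcal H$ of functions $X\colon\Omega\to\mathbb R$ containing the constants and $|X|$ for each $X\in\mathcal H$, and a functional $\mathcal E\colon\mathcal H\to\mathbb R$ that is monotone, convex and satisfies $\mathcal E[c]=c$ for constants $c$. It is assumed that $f(X)\in\mathcal H$ for bounded continuous $f$ and random vectors $X$ with components in $\mathcal H$. A condition such as $\mathcal E[c|\xi_1|^2]<\infty$ includes the requirement $|\xi_1|^2\in\mathcal H$. The sequence $(\xi_n)$ is iid if $\mathcal E[f(\xi_n)]=\mathcal E[f(\xi_1)]$ for all $n$ and bounded continuous $f$, and each $\xi_{n+1}$ is independent of $(\xi_1,\dots,\xi_n)$, i.e. $\mathcal E[f(\xi_1,\dots,\xi_n,\xi_{n+1})]=\mathcal E\big[\mathcal E[f(x,\xi_{n+1})]|_{x=(\xi_1,\dots,\xi_n)}\big]$ for all bounded continuous $f\colon\mathbb R^{(n+1)d}\to\mathbb R$. $C_b$ is the space of bounded continuous functions $\mathbb R^d\to\mathbb R$; $\mathrm{Lip}_b(r)$ is the set of $r$-Lipschitz $f\colon\mathbb R^d\to\mathbb R$ with $\sup|f|\le r$; $|\cdot|$ is the Euclidean norm. $\eta\colon\mathbb R_+\times\mathbb R^d\to\mathbb R_+$ (with $\mathbb R_+=[0,\infty)$) is a fixed infinitely differentiable function with support in $[0,1]\times\{|y|\le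 1\}$ and integral $1$, and $b_{k,l}:=\max_{|\alpha|=l}\|\partial_t^kD^\alpha\eta\|_{L^1(\mathbb R_+\times\mathbb R^d)}$ for $k,l\in\mathbb N_0$ ($\partial_t$ in the first variable, $D^\alpha$ in the $\mathbb R^d$-variable). *)

(* Defs.v *)
From HB Require Import structures.
From mathcomp Require Import all_boot all_order all_algebra.
From mathcomp Require Import all_classical all_reals all_analysis.

Set Implicit Arguments.
Unset Strict Implicit.
Unset Printing Implicit Defensive.

Import Order.TTheory GRing.Theory Num.Theory.
Import numFieldNormedType.Exports.

Local Open Scope classical_set_scope.
Local Open Scope ring_scope.

(* The norm that the library puts on 'rV[R]_d is the max norm; the topology is
   the Euclidean one, but Lipschitz constants and moments need |.| itself. *)
Definition dotv (R : realType) (d : nat) (x y : 'rV[R]_d) : R :=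
  \sum_(i < d) x 0 i * y 0 i.

Definition enorm (R : realType) (d : nat) (x : 'rV[R]_d) : R :=
  Num.sqrt (\sum_(i < d) x 0 i ^+ 2).

Definition bounded_continuous (R : realType) (T : topologicalType)
    (f : T -> R) : Prop :=
  continuous f /\ exists M : R, forall x, `|f x| <= M.

Definition Lipb (R : realType) (d : nat) (r : R) (f : 'rV[R]_d -> R) : Prop :=
  (forall x y, `|f x - f y| <= r * enorm (x - y)) /\ (forall x, `|f x| <= r).

(* The functional E is a total function on Omega -> R, but it is constrained,
   and meant to be evaluated, only on the space H. *)
Record convex_expectation_space (R : realType) (Omega : Type)
    (H : set (Omega -> R)) (E : (Omega -> R) -> R) : Prop :=
  ConvexExpectationSpace {
    ces_cst : forall c : R, H (fun=> c);
    ces_linear : forall (a : R) (X Y : Omega -> R),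
      H X -> H Y -> H (fun w => a * X w + Y w);
    ces_abs : forall X : Omega -> R, H X -> H (fun w => `|X w|);
    ces_bounded_continuous :
      forall (m : nat) (X : Omega -> 'rV[R]_m) (f : 'rV[R]_m -> R),
        (forall i, H (fun w => X w 0 i)) -> bounded_continuous f ->
        H (fun w => f (X w));
    ces_expect_cst : forall c : R, E (fun=> c) = c;
    ces_monotone : forall X Y : Omega -> R,
      H X -> H Y -> (forall w, X w <= Y w) -> E X <= E Y;
    ces_convex : forall (X Y : Omega -> R) (l : R),
      H X -> H Y -> 0 <= l <= 1 ->
      E (fun w => l * X w + (1 - l) * Y w) <= l * E X + (1 - l) * E Y }.

(* m vectors of R^d are the rows of an m x d matrix, so that R^((m + 1) d) is
   'M[R]_(m + 1, d).  That the inner expectation defines an element of H is part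
   of the meaning of the outer expectation. *)
Definition independent_of (R : realType) (Omega : Type)
    (H : set (Omega -> R)) (E : (Omega -> R) -> R) (m d : nat)
    (Y : Omega -> 'rV[R]_d) (X : Omega -> 'M[R]_(m, d)) : Prop :=
  forall f : 'M[R]_(m + 1, d) -> R, bounded_continuous f ->
    let F (x : 'M[R]_(m, d)) := E (fun w => f (col_mx x (Y w))) in
    H (fun w => F (X w)) /\
    E (fun w => f (col_mx (X w) (Y w))) = E (fun w => F (X w)).

Definition stack (R : realType) (Omega : Type) (d : nat)
    (xi : nat -> Omega -> 'rV[R]_d) (m : nat) (w : Omega) : 'M[R]_(m, d) :=
  \matrix_(i < m, j < d) xi i w 0 j.

(* Sequences are indexed from 0: xi 0, xi 1, ... stand for xi_1, xi_2, ... *)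
Definition iid (R : realType) (Omega : Type)
    (H : set (Omega -> R)) (E : (Omega -> R) -> R) (d : nat)
    (xi : nat -> Omega -> 'rV[R]_d) : Prop :=
  (forall (n : nat) (f : 'rV[R]_d -> R), bounded_continuous f ->
     E (fun w => f (xi n w)) = E (fun w => f (xi 0%N w))) /\
  (forall n : nat, independent_of H E (xi n.+1) (stack xi n.+1)).

(* With X = xi_1: phi is the conjugate of z |-> E[<z, X>], with values in
   [0, +oo], and Ezeta f stands for E[f(zeta)]. *)
Definition phi (R : realType) (Omega : Type) (E : (Omega -> R) -> R)
    (d : nat) (X : Omega -> 'rV[R]_d) (y : 'rV[R]_d) : \bar R :=
  ereal_sup
    [set (dotv y z - E (fun w => dotv z (X w)))%:E | z in [set: 'rV[R]_d]].

Definition Ezeta (R : realType) (Omega : Type) (E : (Omega -> R) -> R)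
    (d : nat) (X : Omega -> 'rV[R]_d) (f : 'rV[R]_d -> R) : \bar R :=
  ereal_sup [set ((f y)%:E - phi E X y)%E | y in [set: 'rV[R]_d]].

(* d-dimensional Lebesgue measure, on d.-tuple R with its product
   sigma-algebra: the d-fold product of lebesgue_measure. *)
Section lebesgue_tuple.
Variable R : realType.
Notation RM := (measurableTypeR R).

Definition tcons (n : nat) (p : RM * n.-tuple RM) : n.+1.-tuple RM :=
  [tuple of p.1 :: p.2].

Definition tuncons (n : nat) (t : n.+1.-tuple RM) : RM * n.-tuple RM :=
  (thead t, [tuple of behead t]).

Lemma measurable_tcons n : measurable_fun setT (@tcons n).
Proof. exact: (measurable_cons measurable_fst measurable_snd). Qed.

Lemma measurable_tuncons n : measurable_fun setT (@tuncons n).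
Proof.
apply/measurable_fun_pairP; split.
  exact: (measurable_tnth ord0).
exact: measurable_behead.
Qed.

Lemma prod_sigma_finite d1 d2 (T1 : measurableType d1) (T2 : measurableType d2)
    (m1 : {sigma_finite_measure set T1 -> \bar R})
    (m2 : {sigma_finite_measure set T2 -> \bar R}) :
  sigma_finite setT (m1 \x m2)%E.
Proof.
have /sigma_finiteP[F [TF ndF Foo]] := sigma_finiteT m1.
have /sigma_finiteP[G [TG ndG Goo]] := sigma_finiteT m2.
exists (fun n => F n `*` G n).
  rewrite -setXTT TF TG predeqE => -[x y]; split.
    move=> [/= [n _ Fnx] [k _ Gky]]; exists (maxn n k) => //; split.
    - by move: x Fnx; exact/subsetPset/ndF/leq_maxl.
    - by move: y Gky; exact/subsetPset/ndG/leq_maxr.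
  by move=> [n _ []/= ? ?]; split; exists n.
move=> k; have [? ?] := Foo k; have [? ?] := Goo k.
split; first exact: measurableX.
by rewrite product_measure1E// lte_mul_pinfty// ge0_fin_numE.
Qed.

Section cons_measure.
Variables (n : nat)
  (m : {sigma_finite_measure set (n.-tuple RM) -> \bar R}).

Definition cons_measure : set (n.+1.-tuple RM) -> \bar R :=
  pushforward (@lebesgue_measure R \x m)%E (@tcons n).

Let cons_measure0 : cons_measure set0 = 0%E.
Proof. by rewrite /cons_measure /pushforward preimage_set0 measure0. Qed.

Let cons_measure_ge0 A : (0 <= cons_measure A)%E.
Proof. by rewrite /cons_measure /pushforward measure_ge0. Qed.

Let cons_measure_sigma_additive : semi_sigma_additive cons_measure.
Proof.
move=> F mF tF mUF.
have mc (A : set (n.+1.-tuple RM)) :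
    measurable A -> measurable (@tcons n @^-1` A).
  by move=> mA; rewrite -[X in measurable X]setTI; exact: measurable_tcons.
have := @measure_semi_sigma_additive _ _ _ (@lebesgue_measure R \x m)%E
  (fun i => @tcons n @^-1` F i).
rewrite -preimage_bigcup; apply.
- by move=> i; apply: mc.
- apply/trivIsetP => /= i j _ _ ij; rewrite -preimage_setI.
  by move/trivIsetP : tF => /(_ _ _ _ _ ij) ->//; rewrite preimage_set0.
- exact: mc.
Qed.

HB.instance Definition _ := isMeasure.Build _ _ _ cons_measure
  cons_measure0 cons_measure_ge0 cons_measure_sigma_additive.

Lemma cons_measure_sigma_finite : sigma_finite setT cons_measure.
Proof.
have [F UF FE] := prod_sigma_finite (@lebesgue_measure R) m.
have tconsK (p : RM * n.-tuple RM) : tuncons (tcons p) = p.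
  by case: p => x t; rewrite /tuncons /tcons theadE; congr (_, _); exact/val_inj.
exists (fun i => @tuncons n @^-1` F i) => [|i].
  by rewrite -preimage_bigcup -UF preimage_setT.
have [mF Fi] := FE i; split.
  by rewrite -[X in measurable X]setTI; exact: measurable_tuncons.
rewrite /cons_measure /pushforward (_ : _ @^-1` _ = F i)//.
by apply/seteqP; split => p /=; rewrite tconsK.
Qed.

HB.instance Definition _ := Measure_isSigmaFinite.Build _ _ _ cons_measure
  cons_measure_sigma_finite.

End cons_measure.

Fixpoint lebesgue_tuple (d : nat) :
    {sigma_finite_measure set (d.-tuple RM) -> \bar R} :=
  match d with
  | 0 => \d_[tuple]
  | n.+1 => cons_measure (lebesgue_tuple n)
  end.

End lebesgue_tuple.

Fixpoint Ck (R : realType) (V : normedModType R) (k : nat) (g : V -> R) : Prop :=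
  match k with
  | 0 => continuous g
  | k'.+1 => forall v : V, (forall x, derivable g x v) /\ Ck k' ('D_v g)
  end.

Definition smooth (R : realType) (V : normedModType R) (g : V -> R) : Prop :=
  forall k : nat, Ck k g.

(* Functions on R_+ x R^d are represented by functions on R x R^d whose values
   at t < 0 are irrelevant.  Smoothness on the closed half-space is smoothness
   up to the boundary: existence of a smooth extension to R x R^d. *)
Definition smooth_halfspace (R : realType) (d : nat)
    (eta : R * 'rV[R]_d -> R) : Prop :=
  exists2 g : R * 'rV[R]_d -> R, smooth g &
    forall t y, 0 <= t -> eta (t, y) = g (t, y).

Definition row_of_tuple (R : realType) (d : nat) (s : d.-tuple R) : 'rV[R]_d :=
  \row_(j < d) tnth s j.

Definition integral_halfspace (R : realType) (d : nat)
    (g : R * 'rV[R]_d -> R) : R :=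
  \int[(@lebesgue_measure R \x lebesgue_tuple R d)%E]_(p in [set p | 0 <= p.1])
    g (p.1, row_of_tuple p.2).

Record mollifier (R : realType) (d : nat) (eta : R * 'rV[R]_d -> R) : Prop :=
  Mollifier {
    mollifier_smooth : smooth_halfspace eta;
    mollifier_ge0 : forall t y, 0 <= t -> 0 <= eta (t, y);
    mollifier_support : forall t y,
      0 <= t -> eta (t, y) != 0 -> t <= 1 /\ enorm y <= 1;
    mollifier_integral : integral_halfspace eta = 1 }.

Definition Dmulti (R : realType) (d : nat) (alpha : 'I_d -> nat)
    (g : 'rV[R]_d -> R) : 'rV[R]_d -> R :=
  foldr (fun i => iter (alpha i) (fun h => 'D_(delta_mx 0 i) h)) g (enum 'I_d).

(* At t > 0 this depends only on eta near t; the junk value at t = 0 is not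
   seen by the integral below. *)
Definition dtDx (R : realType) (d k : nat) (alpha : 'I_d -> nat)
    (eta : R * 'rV[R]_d -> R) (p : R * 'rV[R]_d) : R :=
  derive1n k (fun t : R => Dmulti alpha (fun y => eta (t, y)) p.2) p.1.

(* The maximum over |alpha| = l; each alpha_i is then at most l. *)
Definition bnorm (R : realType) (d : nat) (eta : R * 'rV[R]_d -> R)
    (k l : nat) : R :=
  \big[Num.max/0]_(alpha : {ffun 'I_d -> 'I_l.+1} |
                     (\sum_(i < d) alpha i)%N == l)
    integral_halfspace
      (fun p => `|dtDx k (fun i => nat_of_ord (alpha i)) eta p|).

Definition crate (R : realType) (Omega : Type) (E : (Omega -> R) -> R)
    (d : nat) (X : Omega -> 'rV[R]_d) (r : R) : R :=
  2 * r + E (fun w => Num.sqrt d%:R * r * enorm (X w)).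

Definition crate_minus (R : realType) (Omega : Type) (E : (Omega -> R) -> R)
    (d : nat) (X : Omega -> 'rV[R]_d) (eta : R * 'rV[R]_d -> R) (r : R) : R :=
  let s : R := Num.sqrt d%:R in
  let c := crate E X r in
  let b := bnorm eta in
  8 * r + 5 * E (fun w => s * r * enorm (X w))
  + E (fun w => 2^-1 * d%:R * r * b 0%N 1%N * enorm (X w) ^+ 2
                + s * r * enorm (X w))
  + E (fun w => (s * (c + r) * b 1%N 1%N + s * r) * enorm (X w))
  + 2^-1 * (c + r) * b 2%N 0%N.

Definition crate_plus (R : realType) (Omega : Type) (E : (Omega -> R) -> R)
    (d : nat) (X : Omega -> 'rV[R]_d) (eta : R * 'rV[R]_d -> R) (r : R) : R :=
  let s : R := Num.sqrt d%:R in
  let c := crate E X r in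
  let b := bnorm eta in
  8 * r + 5 * E (fun w => s * r * enorm (X w))
  + E (fun w => 2^-1 * d%:R * r * b 0%N 1%N * enorm (X w) ^+ 2
                + s * r * enorm (X w))
  + E (fun w => (s * (2 * c + r) * b 1%N 1%N + s * r) * enorm (X w))
  + 2^-1 * (2 * c + r) * b 2%N 0%N.

(* Main.v *)
Require Import Defs.
From HB Require Import structures.
From mathcomp Require Import all_boot all_order all_algebra.
From mathcomp Require Import all_classical all_reals all_analysis.
From mathcomp Require Import measurable_realfun ring lra.
Import Order.TTheory GRing.Theory Num.Theory.
Import numFieldNormedType.Exports.
Local Open Scope classical_set_scope.
Local Open Scope ring_scope.

(* Write h = 1/n and let u be the scheme u_n = f,
   u_k(x) = h E[h^-1 u_(k+1)(x + h xi_1)], so that u_0(0) is the scaled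
   expectation of the sample mean, and put L(z) = E[<z, xi_1>].  All test
   functions are smoothed Hopf formulas
     Phi_t(x) = sup_(|z| <= r) (<x,z> - t L(z) - eps/2 |z|^2),
   with eps of order sqrt h.  Each is semiconcave with constant 1/eps, with
   the maximiser z as a superdifferential, so one step of the scheme costs the
   expectation of <z, xi_1> + h/(2 eps) |xi_1|^2, which by convexity of E
   differs from L(z) by O(sqrt h).

   Lower bound: starting from f >= f(y) - r|. - y|, the functions
   -Phi_0(. - k h y) are subsolutions up to the cost phi(y).
   Upper bound: if f - phi <= M everywhere, then, f being r-Lipschitz, convex
   duality gives f(x) <= M + sup_(|z| <= r) (<x,z> - L(z)), and Phi_(k h) is a
   supersolution because t enters its definition linearly.

   Both errors are at most
   (r + E[r|xi_1| + r/4 |xi_1|^2] + E[r|xi_1|]) / sqrt n,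
   which is below the stated constants once b_(0,1) >= 1/2; this follows by
   integrating eta along lines in the first space direction. *)

Set Implicit Arguments.
Unset Strict Implicit.
Unset Printing Implicit Defensive.

(** * Euclidean space *)

Section euclidean.
Context {R : realType} {d : nat}.
Implicit Types x y z : 'rV[R]_d.

Lemma dotvDl x y z : dotv (x + y) z = dotv x z + dotv y z.
Proof. by rewrite -big_split; apply: eq_bigr => i _; rewrite mxE mulrDl. Qed.

Lemma dotvZl (a : R) x y : dotv (a *: x) y = a * dotv x y.
Proof. by rewrite mulr_sumr; apply: eq_bigr => i _; rewrite mxE mulrA. Qed.

Lemma dotvC x y : dotv x y = dotv y x.
Proof. by apply: eq_bigr => i _; rewrite mulrC. Qed.

Lemma dotvDr x y z : dotv x (y + z) = dotv x y + dotv x z.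
Proof. by rewrite dotvC dotvDl ![dotv _ x]dotvC. Qed.

Lemma dotvZr (a : R) x y : dotv x (a *: y) = a * dotv x y.
Proof. by rewrite dotvC dotvZl dotvC. Qed.

Lemma dotvNl x y : dotv (- x) y = - dotv x y.
Proof. by rewrite -scaleN1r dotvZl mulN1r. Qed.

Lemma dotvNr x y : dotv x (- y) = - dotv x y.
Proof. by rewrite dotvC dotvNl dotvC. Qed.

Lemma dotvBl x y z : dotv (x - y) z = dotv x z - dotv y z.
Proof. by rewrite dotvDl dotvNl. Qed.

Lemma dotvBr x y z : dotv x (y - z) = dotv x y - dotv x z.
Proof. by rewrite dotvDr dotvNr. Qed.

Lemma dotv0l x : dotv 0 x = 0.
Proof. by rewrite -(scale0r 0) dotvZl mul0r. Qed.

Lemma dotv0r x : dotv x 0 = 0.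
Proof. by rewrite dotvC dotv0l. Qed.

Definition dotvE := (dotvDl, dotvDr, dotvNl, dotvNr, dotvZl, dotvZr, dotv0l,
  dotv0r).

Lemma dotvv_ge0 x : 0 <= dotv x x.
Proof. by apply: sumr_ge0 => i _; rewrite -expr2 sqr_ge0. Qed.

Lemma enorm_ge0 x : 0 <= enorm x.
Proof. exact: sqrtr_ge0. Qed.

Lemma sqr_enorm x : enorm x ^+ 2 = dotv x x.
Proof.
rewrite sqr_sqrtr; last by apply: sumr_ge0 => i _; rewrite sqr_ge0.
by apply: eq_bigr => i _; rewrite expr2.
Qed.

Lemma enorm0 : enorm (0 : 'rV[R]_d) = 0.
Proof. by apply/eqP; rewrite -sqrf_eq0 sqr_enorm dotv0l. Qed.

Lemma enormZ (a : R) x : enorm (a *: x) = `|a| * enorm x.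
Proof.
apply/eqP; rewrite -(eqrXn2 (_ : 0 < 2)%N) ?mulr_ge0 ?enorm_ge0//.
by rewrite exprMn !sqr_enorm dotvZl dotvZr mulrA real_normK ?num_real.
Qed.

Lemma enormN x : enorm (- x) = enorm x.
Proof. by rewrite -scaleN1r enormZ normrN1 mul1r. Qed.

Lemma le_coord_enorm x i : `|x 0 i| <= enorm x.
Proof.
rewrite -sqrtr_sqr ler_sqrt ?sumr_ge0// => [|j _]; last exact: sqr_ge0.
by rewrite (bigD1 i)//= lerDl sumr_ge0// => j _; rewrite sqr_ge0.
Qed.

Lemma enorm_eq0 x : (enorm x == 0) = (x == 0).
Proof.
apply/eqP/eqP => [x0|->]; last exact: enorm0.
by apply/rowP => i; apply/eqP; rewrite mxE -normr_le0 -x0 le_coord_enorm.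
Qed.

(** Cauchy-Schwarz, by expanding the nonnegative square of [enorm y *: x - enorm x *: y]. *)
Lemma dotv_le x y : dotv x y <= enorm x * enorm y.
Proof.
have [->|x0] := eqVneq x 0; first by rewrite dotv0l enorm0 mul0r.
have [->|y0] := eqVneq y 0; first by rewrite dotv0r enorm0 mulr0.
have xp : 0 < enorm x by rewrite lt_neqAle eq_sym enorm_eq0 x0 enorm_ge0.
have yp : 0 < enorm y by rewrite lt_neqAle eq_sym enorm_eq0 y0 enorm_ge0.
have := dotvv_ge0 (enorm y *: x - enorm x *: y).
rewrite !dotvE -!sqr_enorm (dotvC y x) => h.
have : 0 <= (enorm x * enorm y) * (2 * (enorm x * enorm y - dotv x y)) by lra.
by rewrite pmulr_rge0 ?mulr_gt0// pmulr_rge0// subr_ge0.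
Qed.

Lemma enormD x y : enorm (x + y) <= enorm x + enorm y.
Proof.
rewrite -(ler_pXn2r (_ : 0 < 2)%N) ?nnegrE ?addr_ge0 ?enorm_ge0//.
rewrite sqrrD !sqr_enorm !dotvE (dotvC y x).
by have := dotv_le x y; lra.
Qed.

Lemma dotv_continuous x : continuous (dotv x).
Proof.
apply: (@continuous_big R _ +%R 0 xpredT (@add_continuous R) _ _
  (fun i (y : 'rV[R]_d) => x 0 i * y 0 i)) => i _ y.
by apply: (@continuousM _ _ (cst (x 0 i)) (fun y : 'rV[R]_d => y 0 i));
  [exact: cst_continuous|exact: coord_continuous].
Qed.

Lemma enorm_continuous : continuous (@enorm R d).
Proof.
move=> y; apply: continuous_comp; last exact: sqrt_continuous.
apply: (@continuous_big R _ +%R 0 xpredT (@add_continuous R) _ _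
  (fun i (y : 'rV[R]_d) => y 0 i ^+ 2)).
move=> i _ {}y; under eq_fun do rewrite expr2.
by apply: (@continuousM _ _ (fun y : 'rV[R]_d => y 0 i)); exact: coord_continuous.
Qed.

Lemma continuous_enorm_lip (f : 'rV[R]_d -> R) (k : R) :
  (forall x y, `|f x - f y| <= k * enorm (x - y)) -> continuous f.
Proof.
move=> fk x; apply/(@cvgrPdist_lt _ _ _ (nbhs x)) => e e0.
have ck : {for x, continuous (fun y => k * enorm (x - y))}.
  apply: (@continuousM _ _ (cst k) (fun y => enorm (x - y))).
    exact: cst_continuous.
  apply: (@continuous_comp _ _ _ (fun y => x - y) (@enorm R d)).
    by apply: (@continuousB _ _ _ (cst x) id);
      [exact: cst_continuous|exact: cvg_id].
  exact: enorm_continuous.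
move: ck; rewrite /prop_for /continuous_at subrr enorm0 mulr0.
move=> /cvgrPdist_lt /(_ _ e0); apply: filterS => y.
rewrite sub0r normrN; apply: le_lt_trans.
exact: le_trans (fk x y) (ler_norm _).
Qed.

Lemma compact_eball (r : R) : compact [set x : 'rV[R]_d | enorm x <= r].
Proof.
apply: bounded_closed_compact.
  exists r; split=> [|s rs x /= xr]; first exact: num_real.
  rewrite /Num.norm/= mx_normrE; apply/bigmax_leP; split=> [|[i j] _ /=].
    by rewrite (le_trans (enorm_ge0 x))// (le_trans xr)// ltW.
  by rewrite (ord1 i) (le_trans (le_coord_enorm _ _))// (le_trans xr)// ltW.
rewrite (_ : mkset _ = @enorm R d @^-1` [set s | s <= r])//.
by apply: closed_comp => [x _|]; [exact: enorm_continuous|exact: closed_le].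
Qed.

End euclidean.

(** * Convex expectations *)

Section convex_expectation.
Context {R : realType} {Omega : Type}.
Variables (H : set (Omega -> R)) (E : (Omega -> R) -> R).
Hypothesis HE : convex_expectation_space H E.
Implicit Types X Y : Omega -> R.

Lemma ces_scale (a : R) X : H X -> H (fun w => a * X w).
Proof.
move=> HX; have := ces_linear HE a HX (ces_cst HE 0).
by congr H; apply/funext => w; rewrite addr0.
Qed.

Lemma ces_add X Y : H X -> H Y -> H (fun w => X w + Y w).
Proof.
move=> HX HY; have := ces_linear HE 1 HX HY.
by congr H; apply/funext => w; rewrite mul1r.
Qed.

Lemma ces_opp X : H X -> H (fun w => - X w).
Proof.
move=> /(ces_scale (- 1)).
by congr H; apply/funext => w; rewrite mulN1r.
Qed.

Lemma ces_sum (I : Type) (s : seq I) (X : I -> Omega -> R) :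
  (forall i, H (X i)) -> H (fun w => \sum_(i <- s) X i w).
Proof.
move=> HX; elim: s => [|i s ih].
  by under eq_fun do rewrite big_nil; exact: (ces_cst HE).
by under eq_fun do rewrite big_cons; exact: ces_add.
Qed.

Lemma ces_dotv d (X : Omega -> 'rV[R]_d) (z : 'rV[R]_d) :
  (forall i, H (fun w => X w 0 i)) -> H (fun w => dotv z (X w)).
Proof. by move=> HX; apply: ces_sum => i; exact: ces_scale. Qed.

Lemma expect_ge0 X : H X -> (forall w, 0 <= X w) -> 0 <= E X.
Proof.
move=> HX X0; rewrite -(ces_expect_cst HE 0).
exact: ces_monotone HE _ _ (ces_cst HE 0) HX X0.
Qed.

(** [X + l Y] lies on the segment from [X] to [X + Y]. A small [l] thus makes the effect of a
    quadratic term [Y] linear in [l], although [E] is not homogeneous. *)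
Lemma expect_interp X Y (l : R) : H X -> H Y -> 0 <= l <= 1 ->
  E (fun w => X w + l * Y w) <= E X + l * (E (fun w => X w + Y w) - E X).
Proof.
move=> HX HY l01; have := ces_convex HE (ces_add HX HY) HX l01.
have -> : (fun w => l * (X w + Y w) + (1 - l) * X w) =
  (fun w => X w + l * Y w) by apply/funext => w; ring.
by move=> /le_trans; apply; lra.
Qed.

(** The zero function is the midpoint of [X] and [- X]. *)
Lemma expect_oppr X : H X -> - E X <= E (fun w => - X w).
Proof.
move=> HX; have l01 : 0 <= (2^-1 : R) <= 1 by lra.
have := ces_convex HE HX (ces_opp HX) l01.
have -> : (fun w => 2^-1 * X w + (1 - 2^-1) * - X w) = (fun=> 0).
  by apply/funext => w; lra.
by rewrite (ces_expect_cst HE); lra.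
Qed.

(* [X] is the convex combination of [X - l Y] and [X + Y] with weights
   [1 / (1 + l)] and [l / (1 + l)]. *)
Lemma expect_interpN X Y (l : R) : H X -> H Y -> 0 <= l ->
  E X - l * (E (fun w => X w + Y w) - E X) <= E (fun w => X w - l * Y w).
Proof.
move=> HX HY l0.
have HXY : H (fun w => X w - l * Y w).
  have := ces_add HX (ces_scale (- l) HY).
  by congr H; apply/funext => w; ring.
have l1 : 0 < 1 + l by lra.
have m01 : 0 <= (1 + l)^-1 <= 1 by rewrite invr_ge0 ltW//= invf_le1//; lra.
have := ces_convex HE HXY (ces_add HX HY) m01.
have -> : (fun w => (1 + l)^-1 * (X w - l * Y w) +
    (1 - (1 + l)^-1) * (X w + Y w)) = X.
  by apply/funext => w; field; rewrite gt_eqF.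
rewrite -(ler_pM2l l1) mulrDr !mulrA mulrBr divff ?gt_eqF// mulr1.
by lra.
Qed.

(* The map [c |-> E (X + c) - c] is convex and bounded above on the whole
   line, hence constant. *)
Lemma expect_addr X (c : R) : H X -> E (fun w => X w + c) = E X + c.
Proof.
move=> HX; pose k s := E (fun w => X w + s) - s.
have HXs s : H (fun w => X w + s) by exact: ces_add HX (ces_cst HE s).
have kC s : k s <= 2^-1 * E (fun w => 2 * X w).
  have l01 : 0 <= (2^-1 : R) <= 1 by lra.
  have := ces_convex HE (ces_scale 2 HX) (ces_cst HE (2 * s)) l01.
  have -> : (fun w => 2^-1 * (2 * X w) + (1 - 2^-1) * (2 * s)) =
    (fun w => X w + s) by apply/funext => w; field.
  by rewrite (ces_expect_cst HE) /k; lra.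
suff kle s t : k s <= k t.
  have : k c = k 0 by apply/eqP; rewrite eq_le !kle.
  by rewrite /k subr0; under [in RHS]eq_fun do rewrite addr0; lra.
have [->//|st] := eqVneq s t.
apply/ler_addgt0Pr => e e0; set C := 2^-1 * _ in kC.
have D0 : 0 <= C - k t by rewrite subr_ge0.
(* [s] is the average of [t] and the far point [t + (s - t) / l], with weight [l] on the latter,
   where [k] is at most [C]; this [l] makes the excess [l * (C - k t)] at most [e]. *)
pose l := e / (e + (C - k t)).
have l0 : 0 < l by rewrite divr_gt0//; lra.
have l1 : l <= 1 by rewrite ler_pdivrMr ?mul1r; lra.
have l01 : 0 <= l <= 1 by rewrite ltW.
have lC : l * (C - k t) <= e.
  rewrite /l mulrAC ler_pdivrMr; last lra.
  by rewrite ler_pM2l; lra.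
have := ces_convex HE (HXs (t + (s - t) / l)) (HXs t) l01.
have -> : (fun w => l * (X w + (t + (s - t) / l)) + (1 - l) * (X w + t)) =
  (fun w => X w + s) by apply/funext => w; field; rewrite gt_eqF.
have := kC (t + (s - t) / l); rewrite -/C.
have -> : E (fun w => X w + s) = k s + s by rewrite /k; ring.
have -> : E (fun w => X w + t) = k t + t by rewrite /k; ring.
have -> u : E (fun w => X w + u) = k u + u by rewrite /k; ring.
set K := k (_ + _) => KC.
have -> : l * (K + (t + (s - t) / l)) + (1 - l) * (k t + t) =
   s + k t + l * (K - k t) by field; rewrite gt_eqF.
have : l * (K - k t) <= l * (C - k t) by rewrite ler_pM2l//; lra.
by lra.
Qed.

End convex_expectation.

(** * Hopf formulas *)

Section hopf_formula.
Context {R : realType} {Omega : Type} {d : nat}.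
Variables (H : set (Omega -> R)) (E : (Omega -> R) -> R).
Hypothesis HE : convex_expectation_space H E.
Variable X : Omega -> 'rV[R]_d.
Hypothesis X_H : forall i, H (fun w => X w 0 i).
Hypothesis enormX_H : H (fun w => enorm (X w)).
Implicit Types x y z q : 'rV[R]_d.

Definition cumulant z : R := E (fun w => dotv z (X w)).

Lemma cumulant0 : cumulant 0 = 0.
Proof.
rewrite /cumulant; under eq_fun do rewrite dotv0l.
exact: (ces_expect_cst HE).
Qed.

Lemma cumulant_convex z q (t : R) : 0 <= t <= 1 ->
  cumulant (z + t *: (q - z)) <= cumulant z + t * (cumulant q - cumulant z).
Proof.
move=> t01; have := ces_convex HE (ces_dotv HE q X_H) (ces_dotv HE z X_H) t01.
have -> : (fun w => t * dotv q (X w) + (1 - t) * dotv z (X w)) =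
  (fun w => dotv (z + t *: (q - z)) (X w)).
  by apply/funext => w; rewrite !dotvE; ring.
by rewrite /cumulant => /le_trans; apply; lra.
Qed.

Lemma expect_enorm_mono (a b : R) : a <= b ->
  E (fun w => a * enorm (X w)) <= E (fun w => b * enorm (X w)).
Proof.
move=> ab; apply: (ces_monotone HE) => [||w]; try exact: (ces_scale HE).
by rewrite ler_wpM2r ?enorm_ge0.
Qed.

Lemma cumulant_le z (a : R) : enorm z <= a ->
  cumulant z <= E (fun w => a * enorm (X w)).
Proof.
move=> za; apply: (ces_monotone HE) => [||w].
- exact: (ces_dotv HE).
- exact: (ces_scale HE).
- by rewrite (le_trans (dotv_le _ _))// ler_wpM2r ?enorm_ge0.
Qed.

Lemma cumulant_ge z (a : R) : enorm z <= a ->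
  - E (fun w => a * enorm (X w)) <= cumulant z.
Proof.
move=> za; rewrite lerNl (le_trans (expect_oppr HE (ces_dotv HE z X_H)))//.
under eq_fun do rewrite -dotvNl; apply: cumulant_le; by rewrite enormN.
Qed.

(** Secant slopes of a convex function increase with the step, so a step of length at most one is
    compared with the unit step in the same direction [u], whose increment is bounded by moments of
    [X]. *)
Lemma cumulant_lip z q : enorm (q - z) <= 1 ->
  cumulant q - cumulant z <= enorm (q - z) *
  (E (fun w => (enorm z + 1) * enorm (X w)) + E (fun w => enorm z * enorm (X w))).
Proof.
have [->|qz qz1] := eqVneq q z; first by rewrite !subrr enorm0 mul0r.
have e0 : enorm (q - z) != 0 by rewrite enorm_eq0 subr_eq0.
pose u := (enorm (q - z))^-1 *: (q - z).
have u1 : enorm u = 1 by rewrite enormZ ger0_norm ?invr_ge0 ?enorm_ge0// mulVf.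
have l01 : 0 <= enorm (q - z) <= 1 by rewrite enorm_ge0.
have := expect_interp HE (ces_dotv HE z X_H) (ces_dotv HE u X_H) l01.
have -> : (fun w => dotv z (X w) + enorm (q - z) * dotv u (X w)) =
    (fun w => dotv q (X w)).
  by apply/funext => w; rewrite -dotvZl scalerA divff// scale1r !dotvE; ring.
under [in X in _ * (X - _)]eq_fun do rewrite -dotvDl.
rewrite -!/(cumulant _) => h.
suff : enorm (q - z) * (cumulant (z + u) - cumulant z) <= enorm (q - z) *
  (E (fun w => (enorm z + 1) * enorm (X w)) + E (fun w => enorm z * enorm (X w))).
  by move: h; lra.
apply: ler_wpM2l; first exact: enorm_ge0.
apply: lerD; last by rewrite lerNl cumulant_ge.
by apply: cumulant_le; rewrite -u1 enormD.
Qed.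

Lemma cumulant_continuous : continuous cumulant.
Proof.
move=> z; pose C := E (fun w => (enorm z + 2) * enorm (X w)) +
  E (fun w => (enorm z + 1) * enorm (X w)).
have C0 : 0 <= C.
  have EX0 a : 0 <= a -> 0 <= E (fun w => a * enorm (X w)).
    move=> a0; apply: (expect_ge0 HE); first exact: (ces_scale HE).
    by move=> w; rewrite mulr_ge0 ?enorm_ge0.
  by rewrite addr_ge0 ?EX0// addr_ge0// enorm_ge0.
have le1 q : enorm (z - q) <= 1 -> `|cumulant z - cumulant q| <= C * enorm (z - q).
  move=> zq; have qz : enorm (q - z) = enorm (z - q) by rewrite -opprB enormN.
  have qb : enorm q <= enorm z + 1.
    have -> : q = z + (q - z) by rewrite addrC subrK.
    by rewrite (le_trans (enormD _ _))// qz lerD2l.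
  rewrite ler_norml; apply/andP; split.
    rewrite lerNl opprB mulrC -qz (le_trans (cumulant_lip _))// ?qz//.
    rewrite ler_wpM2l ?enorm_ge0// lerD// expect_enorm_mono ?lerD2l//; lra.
  rewrite mulrC (le_trans (cumulant_lip _))//.
  rewrite ler_wpM2l ?enorm_ge0// lerD// expect_enorm_mono//; lra.
apply/(@cvgrPdist_lt _ _ _ (nbhs z)) => e e0.
have ez : {for z, continuous (fun q => enorm (z - q))}.
  apply: (@continuous_comp _ _ _ (fun y => z - y) (@enorm R d)).
    by apply: (@continuousB _ _ _ (cst z) id); [exact: cst_continuous|exact: cvg_id].
  exact: enorm_continuous.
move: ez; rewrite /prop_for /continuous_at subrr enorm0 => /cvgrPdist_lt h.
have m0 : 0 < Num.min 1 (e / (C + 1)) by rewrite lt_min ltr01/= divr_gt0//; lra.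
apply: filterS (h _ m0) => q; rewrite sub0r normrN ger0_norm ?enorm_ge0//.
rewrite lt_min => /andP[q1 q2]; rewrite (le_lt_trans (le1 _ (ltW q1)))//.
move: q2; rewrite ltr_pdivlMr; last lra.
by move=> /le_lt_trans; apply; rewrite mulrC ler_wpM2l ?enorm_ge0//; lra.
Qed.

(** The supremum over the ball is Hopf's formula for d_t u + L(grad u) = 0 whose initial datum is
    the Moreau envelope of r|x|. The quadratic term makes the maximiser stable, hence [hopf]
    semiconcave in [x]. *)
Definition hopf_arg (eps t : R) x z : R :=
  dotv x z - t * cumulant z - eps / 2 * dotv z z.

Definition hopf (r eps t : R) x : R :=
  sup [set hopf_arg eps t x z | z in [set z | enorm z <= r]].

Lemma eball_max (r : R) (g : 'rV[R]_d -> R) : 0 <= r -> continuous g ->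
  exists2 z, enorm z <= r & forall q, enorm q <= r -> g q <= g z.
Proof.
move=> r0 cg.
have [||z] := @compact_EVT_max _ _ g _ _ (@compact_eball R d r).
- by exists 0; rewrite /= enorm0.
- exact: continuous_subspaceT.
rewrite inE => /= zr zmax; exists z => // q qr.
by apply: zmax; rewrite inE.
Qed.

Lemma hopf_arg_continuous (eps t : R) x : continuous (hopf_arg eps t x).
Proof.
have -> : hopf_arg eps t x = (fun z => dotv x z - t * cumulant z -
    eps / 2 * (enorm z * enorm z)).
  by apply/funext => z; rewrite -expr2 sqr_enorm.
move=> z; apply: (@continuousB _ _ _ (fun z => dotv x z - t * cumulant z)
  (fun z => eps / 2 * (enorm z * enorm z))).
  apply: (@continuousB _ _ _ (dotv x) (fun z => t * cumulant z)).
    exact: dotv_continuous.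
  apply: (@continuousM _ _ (cst t) cumulant); first exact: cst_continuous.
  exact: cumulant_continuous.
apply: (@continuousM _ _ (cst (eps / 2)) (fun z => enorm z * enorm z)).
  exact: cst_continuous.
by apply: (@continuousM _ _ (@enorm R d)); exact: enorm_continuous.
Qed.

Lemma hopf_max (r eps t : R) x : 0 <= r -> exists z, [/\ enorm z <= r,
  hopf r eps t x = hopf_arg eps t x z &
  forall q, enorm q <= r -> hopf_arg eps t x q <= hopf_arg eps t x z].
Proof.
move=> r0; have [z zr zmax] := eball_max r0 (@hopf_arg_continuous eps t x).
exists z; split => //; apply/eqP; rewrite eq_le; apply/andP; split.
  apply: ge_sup => [|_ [q /= qr <-]]; last exact: zmax.
  by exists (hopf_arg eps t x z), z.
apply: ub_le_sup; last by exists z.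
by exists (hopf_arg eps t x z) => _ [q /= qr <-]; exact: zmax.
Qed.

Lemma hopf_ge (r eps t : R) x q : enorm q <= r ->
  hopf_arg eps t x q <= hopf r eps t x.
Proof.
move=> qr; have r0 : 0 <= r by rewrite (le_trans (enorm_ge0 q)).
by have [z [_ -> ]] := hopf_max eps t x r0; exact.
Qed.

Lemma hopf00 (r eps : R) : 0 <= r -> 0 <= eps -> hopf r eps 0 0 = 0.
Proof.
move=> r0 e0; have [z [zr hz _]] := hopf_max eps 0 0 r0.
apply/eqP; rewrite eq_le; apply/andP; split.
  rewrite hz /hopf_arg dotv0l mul0r subrr sub0r lerNl oppr0.
  by rewrite mulr_ge0 ?dotvv_ge0// divr_ge0.
have := @hopf_ge r eps 0 0 0; rewrite enorm0 => /(_ r0).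
by rewrite /hopf_arg !dotv0l mul0r mulr0 subrr subr0.
Qed.

(** Strong concavity: the maximiser [z] is compared with [z + s *: (q - z)], the inequality is
    divided by [s], and [s] is sent to 0. *)
Lemma hopf_arg_strong (r eps t : R) x z q : 0 <= eps -> 0 <= t ->
  enorm z <= r -> enorm q <= r ->
  (forall q, enorm q <= r -> hopf_arg eps t x q <= hopf_arg eps t x z) ->
  hopf_arg eps t x q <= hopf_arg eps t x z - eps / 2 * dotv (q - z) (q - z).
Proof.
move=> e0 t0 zr qr zmax.
have D0 : 0 <= eps / 2 * dotv (q - z) (q - z).
  by rewrite mulr_ge0 ?dotvv_ge0// divr_ge0.
set D := _ * dotv _ _ in D0 *.
have key s : 0 < s -> s <= 1 ->
    hopf_arg eps t x q - hopf_arg eps t x z + D <= s * D.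
  move=> s0 s1.
  have qs : enorm (z + s *: (q - z)) <= r.
    have -> : z + s *: (q - z) = (1 - s) *: z + s *: q.
      by rewrite scalerBr scalerBl scale1r addrA addrAC.
    rewrite (le_trans (enormD _ _))// !enormZ !ger0_norm ?subr_ge0 ?(ltW s0)//.
    have -> : r = (1 - s) * r + s * r by ring.
    by apply: lerD; rewrite ler_wpM2l// ?subr_ge0// ltW.
  have s01 : 0 <= s <= 1 by rewrite ltW.
  have := ler_wpM2l t0 (cumulant_convex z q s01).
  have := zmax _ qs; rewrite /D /hopf_arg.
  set c := cumulant (z + _); rewrite !dotvE (dotvC q z).
  set xz := dotv x z; set xq := dotv x q; set zz := dotv z z; set qq := dotv q q.
  set zq := dotv z q => h1 h2.
  rewrite -(ler_pM2l s0); nra.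
have [D1|D1] := eqVneq D 0.
  by have := key 1 ltr01 (lexx _); rewrite D1; lra.
have Dp : 0 < D by rewrite lt_neqAle eq_sym D1.
apply/ler_addgt0Pr => e ep.
pose s := Num.min 1 (e / D).
have s0 : 0 < s by rewrite lt_min ltr01 divr_gt0.
have := key s s0; rewrite ge_min lexx => /(_ isT).
have : s * D <= e by rewrite -ler_pdivlMr// ge_min lexx orbT.
by lra.
Qed.

(** The maximiser [q] at [x + y] gains [dotv (q - z) y] over [z] but loses eps/2 |q - z|^2 by strong
    concavity; completing the square bounds the net gain by |y|^2 / (2 eps). *)
Lemma hopf_semiconcave (r eps t : R) x y z : 0 < eps -> 0 <= t ->
  enorm z <= r -> hopf r eps t x = hopf_arg eps t x z ->
  (forall q, enorm q <= r -> hopf_arg eps t x q <= hopf_arg eps t x z) ->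
  hopf r eps t (x + y) <= hopf r eps t x + dotv z y + enorm y ^+ 2 / (2 * eps).
Proof.
move=> e0 t0 zr -> zmax; have r0 : 0 <= r by rewrite (le_trans (enorm_ge0 z)).
have [q [qr -> _]] := hopf_max eps t (x + y) r0.
have := hopf_arg_strong (ltW e0) t0 zr qr zmax.
have -> : hopf_arg eps t (x + y) q = hopf_arg eps t x q + dotv z y +
    dotv (q - z) y.
  by rewrite /hopf_arg !dotvE (dotvC y q); ring.
rewrite -sqr_enorm; have := dotv_le (q - z) y.
set a := enorm (q - z); set b := enorm y.
suff : a * b <= b ^+ 2 / (2 * eps) + eps / 2 * a ^+ 2 by lra.
have -> : b ^+ 2 / (2 * eps) + eps / 2 * a ^+ 2 =
    a * b + (b - eps * a) ^+ 2 / (2 * eps) by field; rewrite gt_eqF.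
by rewrite lerDl divr_ge0 ?sqr_ge0// mulr_ge0// ltW.
Qed.

Lemma barrier_continuous (a r : R) x : continuous (fun z =>
  dotv x z - cumulant z + a * Num.sqrt (r ^+ 2 - enorm z ^+ 2)).
Proof.
move=> z; apply: (@continuousD _ _ _ (fun z => dotv x z - cumulant z)
  (fun z => a * Num.sqrt (r ^+ 2 - enorm z ^+ 2))).
  apply: (@continuousB _ _ _ (dotv x) cumulant); first exact: dotv_continuous.
  exact: cumulant_continuous.
apply: (@continuousM _ _ (cst a)
  (fun z => Num.sqrt (r ^+ 2 - enorm z ^+ 2))); first exact: cst_continuous.
apply: (@continuous_comp _ _ _ (fun z => r ^+ 2 - enorm z ^+ 2)).
  apply: (@continuousB _ _ _ (cst (r ^+ 2)) (fun z => enorm z ^+ 2)).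
    exact: cst_continuous.
  by apply: (@continuousM _ _ (@enorm R d) (@enorm R d)); exact: enorm_continuous.
exact: sqrt_continuous.
Qed.

(* The slope of the square root at the boundary of the ball is infinite. *)
Lemma barrier_interior (a r : R) x z : 0 < a -> 0 < r -> enorm z <= r ->
  (forall q, enorm q <= r ->
    dotv x q - cumulant q + a * Num.sqrt (r ^+ 2 - enorm q ^+ 2) <=
    dotv x z - cumulant z + a * Num.sqrt (r ^+ 2 - enorm z ^+ 2)) ->
  enorm z < r.
Proof.
move=> a0 r0 zr zmax; rewrite lt_neqAle zr andbT; apply/eqP => zE.
set A := dotv x z - cumulant z in zmax.
(* Shrinking [z] by the factor 1 - s^2 changes the concave part by order s^2, while the square root
   rises from 0 to at least r s; this [s] makes the two incompatible with maximality. *)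
pose s := Num.min 1 (a * r / (2 * (`|A| + 1))).
have A1 : 0 < 2 * (`|A| + 1) by have := normr_ge0 A; lra.
have s0 : 0 < s by rewrite lt_min ltr01/= divr_gt0// mulr_gt0.
have s1 : s <= 1 by rewrite ge_min lexx.
have sA : s * (2 * (`|A| + 1)) <= a * r.
  by rewrite -ler_pdivlMr// ge_min lexx orbT.
have t01 : 0 <= 1 - s ^+ 2 <= 1 by apply/andP; split; nra.
have /andP[t0 t1] := t01.
have q_norm : enorm ((1 - s ^+ 2) *: z) = (1 - s ^+ 2) * r.
  by rewrite enormZ ger0_norm// zE.
have qr : enorm ((1 - s ^+ 2) *: z) <= r by rewrite q_norm ler_piMl// ltW.
have := zmax _ qr; rewrite q_norm zE subrr sqrtr0 mulr0 addr0.
have : r * s <= Num.sqrt (r ^+ 2 - ((1 - s ^+ 2) * r) ^+ 2).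
  rewrite -[leLHS]ger0_norm ?mulr_ge0 ?(ltW r0) ?(ltW s0)// -sqrtr_sqr ler_wsqrtr//.
  rewrite !exprMn -{2}[r ^+ 2]mul1r -mulrBl mulrC ler_wpM2r ?sqr_ge0//.
  by have s2 : s ^+ 2 <= 1; [nra|]; have := sqr_ge0 s; nra.
have := @cumulant_convex 0 z _ t01.
rewrite subr0 add0r cumulant0 subr0 add0r dotvZr => h1 h2 h3.
have h4 : a * (r * s) <= s ^+ 2 * A.
  have := ler_wpM2l (ltW a0) h2; move: h1 h3; rewrite /A; nra.
have : a * r <= s * A by rewrite -(ler_pM2l s0); move: h4; rewrite expr2; nra.
have : s * A <= s * `|A| by rewrite ler_wpM2l ?ler_norm// ltW.
by have := mulr_gt0 a0 r0; nra.
Qed.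

(** Fermat's rule at an interior maximiser: the multiple of [z] subtracted from [x] is minus the
    gradient of the barrier, and convexity of [cumulant] makes the first-order condition a global
    inequality. *)
Lemma barrier_subgradient (a r : R) x z q : 0 < a -> 0 < r -> enorm z <= r ->
  (forall q, enorm q <= r ->
    dotv x q - cumulant q + a * Num.sqrt (r ^+ 2 - enorm q ^+ 2) <=
    dotv x z - cumulant z + a * Num.sqrt (r ^+ 2 - enorm z ^+ 2)) ->
  cumulant z +
    dotv (x - (a / Num.sqrt (r ^+ 2 - enorm z ^+ 2)) *: z) (q - z)
  <= cumulant q.
Proof.
move=> a0 r0 zr zmax; have zlt := barrier_interior a0 r0 zr zmax.
set s := Num.sqrt _ in zmax *.
have s2p : 0 < r ^+ 2 - enorm z ^+ 2.
  by rewrite subr_gt0 ltr_pXn2r// nnegrE ?enorm_ge0// ltW.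
have s0 : 0 < s by rewrite sqrtr_gt0.
have s2 : s ^+ 2 = r ^+ 2 - enorm z ^+ 2 by rewrite sqr_sqrtr// ltW.
set b := dotv z (q - z).
(* Instead of differentiating the square root: for [beta] above b/s, the line s - t beta stays below
   the square root at [z + t *: (q - z)] for small [t]. *)
have key beta : b < s * beta ->
    0 <= cumulant q - cumulant z - dotv x (q - z) + a * beta.
  move=> bs; set D := _ + a * beta.
  pose N := beta ^+ 2 + enorm (q - z) ^+ 2 + 1.
  have N0 : 0 < N by rewrite ltr_wpDl// addr_ge0// sqr_ge0.
  have be0 : 0 < `|beta| + 1 by rewrite ltr_wpDl.
  (* The second bound keeps [s - t * beta] nonnegative, the third absorbs the terms quadratic in
     [t]. *)
  pose t := Num.min 1 (Num.min (s / (`|beta| + 1)) (2 * (s * beta - b) / N)).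
  have t0 : 0 < t.
    by rewrite !lt_min ltr01 !divr_gt0// mulr_gt0// subr_gt0.
  have t1 : t <= 1 by rewrite ge_min lexx.
  have tb : t * (`|beta| + 1) <= s.
    by rewrite -ler_pdivlMr// /t !ge_min lexx orbT.
  have tN : t * N <= 2 * (s * beta - b).
    by rewrite -ler_pdivlMr// /t !ge_min lexx !orbT.
  have stb : 0 <= s - t * beta.
    by have := ler_wpM2l (ltW t0) (ler_norm beta); lra.
  have zt2 : (s - t * beta) ^+ 2 + enorm (z + t *: (q - z)) ^+ 2 <= r ^+ 2.
    rewrite sqr_enorm dotvDl !dotvDr !dotvZl !dotvZr (dotvC (q - z) z) -/b.
    rewrite -!sqr_enorm; set m := enorm (q - z).
    have -> : r ^+ 2 = s ^+ 2 + enorm z ^+ 2 by rewrite s2 subrK.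
    have := ler_wpM2l (ltW t0) tN; rewrite /N -/m.
    have := mulr_gt0 t0 t0; nra.
  have ztr : enorm (z + t *: (q - z)) <= r.
    rewrite -(ler_pXn2r (_ : 0 < 2)%N) ?nnegrE ?enorm_ge0 ?(ltW r0)//.
    by rewrite (le_trans _ zt2)// lerDr sqr_ge0.
  have sq : s - t * beta <= Num.sqrt (r ^+ 2 - enorm (z + t *: (q - z)) ^+ 2).
    by rewrite -[leLHS]ger0_norm// -sqrtr_sqr ler_wsqrtr// lerBrDr.
  have t01 : 0 <= t <= 1 by rewrite ltW.
  have := zmax _ ztr; have := cumulant_convex z q t01.
  have := ler_wpM2l (ltW a0) sq.
  rewrite dotvDr dotvZr => h1 h2 h3; rewrite -(pmulr_rge0 _ t0) /D.
  by nra.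
suff : 0 <= cumulant q - cumulant z - dotv x (q - z) + a * (b / s).
  rewrite dotvBl dotvZl -/b; have -> : a / s * b = a * (b / s) by ring.
  by lra.
apply/ler_addgt0Pr => e e0.
have bs : b < s * (b / s + e / a).
  by rewrite mulrDr mulrCA divff ?gt_eqF// mulr1 ltrDl mulr_gt0// divr_gt0.
have := key _ bs.
by rewrite mulrDr [a * (e / a)]mulrCA divff ?gt_eqF// mulr1 addrA.
Qed.

(* A point [z] maximising [<x,z> - cumulant z] plus a small barrier for the
   ball is interior, hence [cumulant] has at [z] a subgradient [y] for which
   [x - y] is a nonnegative multiple of [z]; compare [f x] with [f y]. *)
Lemma lipschitz_le_hopf (r M e : R) (f : 'rV[R]_d -> R) x :
  0 < r -> 0 < e -> (forall x y, `|f x - f y| <= r * enorm (x - y)) ->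
  (forall y, ((f y)%:E - phi E X y <= M%:E)%E) ->
  exists2 z, enorm z <= r & f x <= M + (dotv x z - cumulant z) + e.
Proof.
move=> r0 e0 flip fM; pose a := e / r; have a0 : 0 < a by rewrite divr_gt0.
have [z zr zmax] := eball_max (ltW r0) (@barrier_continuous a r x).
have zlt := barrier_interior a0 r0 zr zmax.
have sub q := @barrier_subgradient a r x z q a0 r0 zr zmax.
set s := Num.sqrt _ in sub.
have s2p : 0 < r ^+ 2 - enorm z ^+ 2.
  by rewrite subr_gt0 ltr_pXn2r// nnegrE ?enorm_ge0// ltW.
have s0 : 0 < s by rewrite sqrtr_gt0.
have s2 : s ^+ 2 = r ^+ 2 - enorm z ^+ 2 by rewrite sqr_sqrtr// ltW.
exists z => //; set y := x - _ in sub.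
have phiy : (phi E X y <= (dotv y z - cumulant z)%:E)%E.
  apply: ge_ereal_sup => _ [q _ <-]; rewrite lee_fin -/(cumulant q).
  by have := sub q; rewrite dotvBr; lra.
have fy : f y <= M + (dotv y z - cumulant z).
  have := le_trans (leeB (lexx (f y)%:E) phiy) (fM y).
  by rewrite -EFinB lee_fin; lra.
have xy : x - y = (a / s) *: z by rewrite /y opprB addrC subrK.
have := le_trans (ler_norm _) (flip x y).
have yz : dotv y z = dotv x z - a / s * enorm z ^+ 2.
  by rewrite /y dotvBl dotvZl sqr_enorm.
rewrite yz in fy.
have as0 : 0 < a / s by rewrite divr_gt0.
rewrite xy enormZ (ger0_norm (ltW as0)) => fxy.
(* The Lipschitz bound costs (a/s) r|z| and replacing <y,z> by <x,z> returns (a/s)|z|^2. Since s^2 =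
   (r - |z|)(r + |z|), the factor |z|(r - |z|) is at most r s, and a r = e. *)
suff : a / s * (enorm z * (r - enorm z)) <= e by move: fy fxy; nra.
have -> : e = a / s * (r * s) by rewrite /a; field; rewrite !gt_eqF.
rewrite ler_pM2l// ler_pM ?enorm_ge0 ?subr_ge0//.
rewrite -(ler_pXn2r (_ : 0 < 2)%N) ?nnegrE ?subr_ge0 ?(ltW s0)//.
by rewrite s2; have := enorm_ge0 z; nra.
Qed.

End hopf_formula.

(** * The approximation scheme *)

Lemma cvg_rowP {R : realType} {d : nat} {T : Type} (F : set_system T)
    {FF : Filter F} (g : T -> 'rV[R]_d) (l : 'rV[R]_d) :
  (forall j, g t 0 j @[t --> F] --> l 0 j) -> g t @[t --> F] --> l.
Proof.
move=> gl A [P lP PA].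
have FP : F [set t | forall j, P 0 j (g t 0 j)].
  by apply: filter_forall => j; apply: (gl j); exact: lP.
have sub : [set t | forall j, P 0 j (g t 0 j)] `<=` g @^-1` A.
  by move=> t Pt; apply: PA => i j; rewrite (ord1 i); exact: Pt.
exact: (filterS sub FP).
Qed.

Section scheme.
Context {R : realType} {Omega : Type} {d : nat}.
Variables (H : set (Omega -> R)) (E : (Omega -> R) -> R).
Hypothesis HE : convex_expectation_space H E.
Variable X : Omega -> 'rV[R]_d.
Hypothesis X_H : forall i, H (fun w => X w 0 i).
Variables (a r : R) (f : 'rV[R]_d -> R).
Hypotheses (a_gt0 : 0 < a) (r_gt0 : 0 < r) (f_Lipb : Lipb r f).

(** With [a = n] this is u_(n-j): the index counts steps back from the terminal value [f]. *)
Fixpoint scheme (j : nat) : 'rV[R]_d -> R :=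
  if j is j'.+1 then
    fun x => a^-1 * E (fun w => a * scheme j' (x + a^-1 *: X w))
  else f.

Lemma Lipb_bounded_continuous (g : 'rV[R]_d -> R) x :
  Lipb r g -> bounded_continuous (fun y : 'rV[R]_d => a * g (x + a^-1 *: y)).
Proof.
move=> [glip gr]; split; last first.
  exists (a * r) => y; rewrite normrM gtr0_norm//.
  by rewrite ler_pM2l.
apply: (@continuous_enorm_lip _ _ _ r) => y z.
rewrite -mulrBr normrM gtr0_norm// (le_trans (ler_wpM2l (ltW a_gt0) (glip _ _)))//.
rewrite opprD addrACA subrr add0r -scalerBr enormZ gtr0_norm ?invr_gt0//.
by rewrite mulrCA mulVKf ?gt_eqF.
Qed.

Lemma Lipb_expect_H (g : 'rV[R]_d -> R) x :
  Lipb r g -> H (fun w => a * g (x + a^-1 *: X w)).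
Proof. by move=> /(Lipb_bounded_continuous x); exact: (ces_bounded_continuous HE). Qed.

(** Constants pass through [E], so monotonicity carries both bounds through a step. Preserving them
    keeps every integrand a bounded continuous function of [X], hence in [H]. *)
Lemma scheme_Lipb j : Lipb r (scheme j).
Proof.
elim: j => [//|j [lipj rj]]; have Lj : Lipb r (scheme j) by [].
have HV x := Lipb_expect_H x Lj.
have le1 x y : scheme j.+1 x <= scheme j.+1 y + r * enorm (x - y).
  rewrite /= -(ler_pM2l a_gt0) mulrDr !mulVKf ?gt_eqF//.
  rewrite -(expect_addr HE)//; apply: (ces_monotone HE) => // [|w].
    exact: (ces_add HE (HV y) (ces_cst HE _)).
  rewrite -mulrDr ler_pM2l//.
  have := le_trans (ler_norm _) (lipj (x + a^-1 *: X w) (y + a^-1 *: X w)).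
  by rewrite opprD addrACA subrr addr0; lra.
split=> [x y|x].
  have := le1 x y; have := le1 y x; rewrite -(opprB x y) enormN ler_norml.
  by move=> ? ?; apply/andP; split; lra.
rewrite /= normrM gtr0_norm ?invr_gt0// ler_pdivrMl// ler_norml.
apply/andP; split.
  rewrite -(ces_expect_cst HE (- (a * r))); apply: (ces_monotone HE) => // [|w].
    exact: (ces_cst HE).
  by rewrite -mulrN ler_pM2l// lerNl -[leRHS]opprK lerN2 lerNl
    (le_trans (ler_norm _))// normrN.
rewrite -(ces_expect_cst HE (a * r)); apply: (ces_monotone HE) => // [|w].
  exact: (ces_cst HE).
by rewrite ler_pM2l// (le_trans (ler_norm _)).
Qed.

Hypothesis enormX_H : H (fun w => enorm (X w)).
Hypothesis sqrX_H : forall c, 0 <= c -> H (fun w => c * enorm (X w) ^+ 2).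
Variable l : R.
Hypotheses (l_gt0 : 0 < l) (l_le1 : l <= 1) (al : a^-1 = l ^+ 2).
(** In use [l] is n^(-1/2). This [eps] balances two errors: smoothing costs eps/2 r^2 = l r, and the
    semiconcavity term of one step is [a^-1 * (l * quad w)]. *)
Let eps := 2 * l / r.
Let L := cumulant E X.

(** Bounds, uniformly in |z| <= r, the increase of E[<z, X>] when the full quadratic term is added
    under [E]. *)
Definition moment_error :=
  E (fun w => r * enorm (X w) + r / 4 * enorm (X w) ^+ 2) +
  E (fun w => r * enorm (X w)).
Let B := moment_error.

Let eps_gt0 : 0 < eps. Proof. by rewrite divr_gt0// mulr_gt0. Qed.

Let quad w := r / 4 * enorm (X w) ^+ 2.

Let quad_H : H quad. Proof. by apply: sqrX_H; rewrite divr_ge0// ltW. Qed.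

Let quadE w : enorm (a^-1 *: X w) ^+ 2 / (2 * eps) = a^-1 * (l * quad w).
Proof.
rewrite enormZ gtr0_norm ?invr_gt0// /quad /eps al.
by field; rewrite !gt_eqF.
Qed.

Lemma dotv_quad_error z : enorm z <= r ->
  E (fun w => dotv z (X w) + quad w) - L z <= B.
Proof.
move=> zr; apply: lerD; last first.
  by rewrite lerNl; exact: (cumulant_ge HE).
apply: (ces_monotone HE) => [||w].
- exact: (ces_add HE (ces_dotv HE z X_H)).
- exact: (ces_add HE (ces_scale HE r enormX_H)).
- by rewrite lerD2r (le_trans (dotv_le _ _))// ler_wpM2r ?enorm_ge0.
Qed.

Lemma expect_quad_le z : enorm z <= r ->
  E (fun w => dotv z (X w) + l * quad w) <= L z + l * B.
Proof.
move=> zr; have l01 : 0 <= l <= 1 by rewrite ltW.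
apply: (le_trans (expect_interp HE (ces_dotv HE z X_H) quad_H l01)).
by rewrite lerD2l ler_pM2l//; exact: dotv_quad_error.
Qed.

(** Slopes of a convex function increase, so subtracting [l * quad] lowers the expectation by at
    most [l] times what adding [quad] raises it; the same [B] serves both directions. *)
Lemma expect_quad_ge z : enorm z <= r ->
  L z - l * B <= E (fun w => dotv z (X w) - l * quad w).
Proof.
move=> zr.
apply: le_trans (expect_interpN HE (ces_dotv HE z X_H) quad_H (ltW l_gt0)).
by rewrite lerD2l lerN2 ler_pM2l//; exact: dotv_quad_error.
Qed.

Let Phi := hopf E X r eps.

(** Semiconcavity linearises [Phi] at its maximiser [z]; the resulting cost [a^-1 * L z] of a step
    is exactly what lowering [t] by [a^-1] gives back, since [z] still competes in the supremum at
    the new time. *)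
Lemma scheme_le (C : R) (j : nat) x : j%:R * a^-1 <= 1 ->
  (forall x, f x <= C + Phi 1 x) ->
  scheme j x <= C + Phi (1 - j%:R * a^-1) x + j%:R * a^-1 * (l * B).
Proof.
move=> + fC; elim: j x => [|j ih] x.
  by rewrite !mul0r subr0 addr0 => _; exact: fC.
move=> j1; have h0 : 0 < a^-1 by rewrite invr_gt0.
have tS : 1 - j%:R * a^-1 = 1 - j.+1%:R * a^-1 + a^-1.
  by rewrite -natr1; ring.
set t' := 1 - j.+1%:R * _ in tS *; have t'0 : 0 <= t' by rewrite subr_ge0.
set t := 1 - _ in tS ih; have t0 : 0 <= t by rewrite tS addr_ge0// ltW.
have {}ih y := ih y ltac:(rewrite -subr_ge0; exact: t0).
have [z [zr PhiE zmax]] := hopf_max HE X_H enormX_H eps t x (ltW r_gt0).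
have Phi_le : Phi t x <= Phi t' x - a^-1 * L z.
  have := hopf_ge HE X_H enormX_H eps t' x zr; rewrite -/Phi.
  by rewrite [Phi t x]PhiE /hopf_arg -/L tS; lra.
have semi y := hopf_semiconcave HE X_H enormX_H y eps_gt0 t0 zr PhiE zmax.
pose K := C + Phi t x + j%:R * a^-1 * (l * B).
have bound w : a * scheme j (x + a^-1 *: X w) <=
    (dotv z (X w) + l * quad w) + a * K.
  have := ih (x + a^-1 *: X w); have := semi (a^-1 *: X w).
  rewrite -/Phi quadE dotvZr => h1 h2.
  rewrite -(ler_pM2l h0) mulrDr !mulKf ?gt_eqF// /K; lra.
rewrite /= -ler_pdivlMl ?invr_gt0// invrK.
apply: le_trans (_ : E (fun w => (dotv z (X w) + l * quad w) + a * K) <= _).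
  apply: (ces_monotone HE) => //; first exact/Lipb_expect_H/scheme_Lipb.
  apply: (ces_add HE _ (ces_cst HE _)).
  exact: (ces_add HE (ces_dotv HE z X_H) (ces_scale HE l quad_H)).
rewrite (expect_addr HE); last first.
  exact: (ces_add HE (ces_dotv HE z X_H) (ces_scale HE l quad_H)).
have := expect_quad_le zr => Ez.
have : L z + l * B + a * K <= a * (C + Phi t' x + j.+1%:R * a^-1 * (l * B)).
  rewrite -(ler_pM2l h0) mulrDr !mulKf ?gt_eqF// -natr1 /K.
  by move: Phi_le; lra.
by apply: le_trans; rewrite lerD2r.
Qed.

Lemma enorm_le_hopf x : r * enorm x - eps / 2 * r ^+ 2 <= Phi 0 x.
Proof.
have D0 : 0 <= eps / 2 * r ^+ 2 by rewrite mulr_ge0 ?sqr_ge0// divr_ge0// ltW.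
have [->|x0] := eqVneq x 0.
  rewrite enorm0 mulr0 sub0r /Phi (hopf00 HE X_H enormX_H (ltW r_gt0) (ltW eps_gt0)).
  by rewrite oppr_le0.
have e0 : 0 < enorm x by rewrite lt_neqAle eq_sym enorm_eq0 x0 enorm_ge0.
pose q := (r / enorm x) *: x.
have qr : enorm q = r.
  by rewrite enormZ gtr0_norm ?divr_gt0// divfK ?gt_eqF.
have qle : enorm q <= r by rewrite qr.
have := hopf_ge HE X_H enormX_H eps 0 x qle.
apply: le_trans; rewrite /hopf_arg -sqr_enorm qr mul0r subr0 lerD2r.
by rewrite dotvZr -sqr_enorm expr2 mulrA divfK ?gt_eqF.
Qed.

(** [p0] stands for a finite value of [phi] at [y0]. The smoothed cone below [f] starts centred at
    [y0], and its centre moves by [a^-1 *: y0] per step, reaching 0 when [j = a]. *)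
Lemma scheme_ge (y0 : 'rV[R]_d) (p0 : R) (j : nat) x :
  (forall z, dotv y0 z - L z <= p0) ->
  f y0 - eps / 2 * r ^+ 2 - Phi 0 (x - (1 - j%:R * a^-1) *: y0)
    - j%:R * a^-1 * (p0 + l * B) <= scheme j x.
Proof.
move=> Lp; elim: j x => [|j ih] x.
  rewrite !mul0r !subr0 scale1r /=.
  have := enorm_le_hopf (x - y0); have := le_trans (ler_norm _) (f_Lipb.1 y0 x).
  by rewrite -(opprB x y0) enormN; lra.
have h0 : 0 < a^-1 by rewrite invr_gt0.
have tS : 1 - j%:R * a^-1 = 1 - j.+1%:R * a^-1 + a^-1.
  by rewrite -natr1; ring.
set t' := 1 - j.+1%:R * _ in tS *; set t := 1 - _ in tS ih.
have xt : x - t *: y0 + a^-1 *: y0 = x - t' *: y0.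
  by rewrite tS scalerDl opprD addrA subrK.
set u := x - t *: y0 in xt.
have [p [pr PhiE pmax]] := hopf_max HE X_H enormX_H eps 0 u (ltW r_gt0).
have Phi_ge : Phi 0 u + a^-1 * dotv p y0 <= Phi 0 (x - t' *: y0).
  have := hopf_ge HE X_H enormX_H eps 0 (u + a^-1 *: y0) pr; rewrite -/Phi -xt.
  by rewrite [Phi 0 u]PhiE /hopf_arg dotvDl dotvZl (dotvC y0); lra.
have semi y :=
  hopf_semiconcave HE X_H enormX_H y eps_gt0 (lexx 0) pr PhiE pmax.
pose K := f y0 - eps / 2 * r ^+ 2 - Phi 0 u - j%:R * a^-1 * (p0 + l * B).
have bound w : (dotv (- p) (X w) - l * quad w) + a * K <=
    a * scheme j (x + a^-1 *: X w).
  have := ih (x + a^-1 *: X w); have := semi (a^-1 *: X w).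
  rewrite -/Phi quadE dotvZr [x + _ - _]addrAC -/u => h1 h2.
  rewrite -(ler_pM2l h0) mulrDr !mulKf ?gt_eqF// /K dotvNl.
  by move: h1 h2; set c0 := f y0 - _; lra.
have HN : H (fun w => dotv (- p) (X w) - l * quad w).
  exact: (ces_add HE (ces_dotv HE _ X_H) (ces_opp HE (ces_scale HE l quad_H))).
rewrite /= -ler_pdivrMl ?invr_gt0// invrK.
apply: (@le_trans _ _ (E (fun w => (dotv (- p) (X w) - l * quad w) + a * K))).
  rewrite (expect_addr HE)//.
  (* The test function is minus [Phi], so its slope is [- p], and [p0] bounds the deficit
     [dotv y0 (- p) - L (- p)] of one step. *)
  have := @expect_quad_ge (- p); rewrite enormN => /(_ pr).
  have := Lp (- p); rewrite dotvNr (dotvC y0) => h1 h2.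
  rewrite -lerBlDr (le_trans _ h2)// -(ler_pM2l h0) mulrBr !mulKf ?gt_eqF//.
  rewrite -[j.+1%:R]natr1 /K; have := ler_wpM2l (ltW h0) h1; move: Phi_ge.
  by set c0 := f y0 - _; lra.
apply: (ces_monotone HE) => //; last exact/Lipb_expect_H/scheme_Lipb.
exact: (ces_add HE HN (ces_cst HE _)).
Qed.

End scheme.

(** * The scheme computes expectations of iid sums *)

Section iid_sums.
Context {R : realType} {Omega : Type} {d : nat}.
Variables (H : set (Omega -> R)) (E : (Omega -> R) -> R).
Hypothesis HE : convex_expectation_space H E.
Variable xi : nat -> Omega -> 'rV[R]_d.
Hypothesis xi_H : forall n i, H (fun w => xi n w 0 i).
Hypothesis xi_iid : iid H E xi.
Variables (a r : R) (f : 'rV[R]_d -> R).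
Hypotheses (a_gt0 : 0 < a) (r_gt0 : 0 < r) (f_Lipb : Lipb r f).

Let V := scheme E (xi 0%N) a f.

Lemma sum_row_continuous m : continuous (fun M : 'M[R]_(m, d) => \sum_i row i M).
Proof.
move=> M; apply: (@cvg_rowP R d _ (nbhs M) (nbhs_filter M)) => j; rewrite summxE.
under eq_fun do rewrite summxE.
apply: (@continuous_big R _ +%R 0 xpredT (@add_continuous R) _ _
  (fun i (M : 'M[R]_(m, d)) => row i M 0 j)) => i _ {}M.
rewrite /continuous_at mxE; under eq_fun do rewrite mxE.
exact: coord_continuous.
Qed.

Lemma sum_row_stack m w : \sum_i row i (stack xi m w) = \sum_(i < m) xi i w.
Proof.
by apply: eq_bigr => i _; apply/rowP => j; rewrite !mxE.
Qed.

Lemma sum_row_col_mx m (M : 'M[R]_(m, d)) (y : 'rV[R]_d) :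
  \sum_i row i (col_mx M y) = \sum_i row i M + y.
Proof.
rewrite big_split_ord big_ord1/=; congr (_ + _).
  by apply: eq_bigr => i _; apply/rowP => j; rewrite [LHS]mxE [RHS]mxE col_mxEu.
by apply/rowP => j; rewrite mxE col_mxEd.
Qed.

(** Independence integrates the last summand first, and identical distribution replaces it by
    [xi 0]: this is one step of the scheme. The sum keeps at least one term because the induction
    starts from [xi 0] itself. *)
Lemma expect_scheme_sum k j :
  E (fun w => a * V j (a^-1 *: \sum_(i < k.+1) xi i w)) = a * V (j + k.+1) 0.
Proof.
have VL i : Lipb r (V i) by exact: (scheme_Lipb HE (xi_H 0) a_gt0 f_Lipb).
have V1 i (x : 'rV[R]_d) : E (fun w => a * V i (x + a^-1 *: xi 0%N w)) = a * V i.+1 x.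
  by rewrite /V/= mulVKf ?gt_eqF.
elim: k j => [|k ih] j.
  rewrite addn1 -V1; congr E; apply/funext => w.
  by rewrite big_ord1 add0r.
pose g (M : 'M[R]_(k.+1 + 1, d)) := a * V j (a^-1 *: \sum_i row i M).
have g_bc : bounded_continuous g.
  have [cV [M VM]] := Lipb_bounded_continuous a_gt0 0 (VL j).
  split; last first.
    by exists M => x; have := VM (\sum_i row i x); rewrite add0r.
  move=> x; apply: (@continuous_comp _ _ _ (fun M => \sum_i row i M)
    (fun y => a * V j (a^-1 *: y))); first exact: sum_row_continuous.
  have -> : (fun y : 'rV[R]_d => a * V j (a^-1 *: y)) =
    (fun y => a * V j (0 + a^-1 *: y)) by apply/funext => y; rewrite add0r.
  exact: cV.
have [_] := xi_iid.2 k g g_bc.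
have -> : (fun w => g (col_mx (stack xi k.+1 w) (xi k.+1 w))) =
    (fun w => a * V j (a^-1 *: \sum_(i < k.+2) xi i w)).
  apply/funext => w; rewrite /g sum_row_col_mx sum_row_stack.
  by rewrite [in RHS]big_ord_recr.
move=> ->; rewrite addnS -addSn -ih; congr E; apply/funext => w.
rewrite -V1 -sum_row_stack; set s := \sum_i _.
have := xi_iid.1 k.+1 (fun y => a * V j (a^-1 *: s + a^-1 *: y))
  (Lipb_bounded_continuous a_gt0 _ (VL j)).
move=> <-; congr E; apply/funext => w'.
by rewrite /g sum_row_col_mx scalerDr.
Qed.

End iid_sums.

(** * The mollifier *)

Section measurability.
Context {R : realType}.
Notation RM := (measurableTypeR R).

(** A preimage is a countable union of fibres of [Q], so [G] may be arbitrary. *)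
Lemma measurable_fun_countable {disp : measure_display}
    {T : measurableType disp} {C : countType} (Q : T -> C) (G : C -> RM) :
  (forall c, measurable (Q @^-1` [set c])) -> measurable_fun setT (G \o Q).
Proof.
move=> mQ _ B _; rewrite setTI.
have -> : (G \o Q) @^-1` B =
    \bigcup_c (if c \in G @^-1` B then Q @^-1` [set c] else set0).
  apply/seteqP; split => [x Bx|x [c _]].
    by exists (Q x) => //; rewrite mem_set.
  by case: ifPn => // /[!inE] Bc /= ->.
apply: countable_bigcupT_measurable => [|c].
  exact: countableP.
by case: ifPn.
Qed.

Definition round (n : nat) (x : R) : R := (Num.floor (n.+1%:R * x))%:~R / n.+1%:R.

Lemma round_cvg x : round n x @[n --> \oo] --> x.
Proof.
have ub n : `|x - round n x| <= n.+1%:R^-1.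
  have n0 : 0 < n.+1%:R :> R by [].
  have /andP[f1 f2] := floor_itv (n.+1%:R * x).
  have -> : x - round n x =
      (n.+1%:R * x - (Num.floor (n.+1%:R * x))%:~R) / n.+1%:R.
    by rewrite /round mulrBl [_ * x]mulrC mulfK ?pnatr_eq0.
  rewrite normrM [X in _ * X]gtr0_norm ?invr_gt0// ler_piMl ?invr_ge0//.
  move: f2; rewrite intrD => f2.
  by rewrite ger0_norm ?subr_ge0//; lra.
apply/cvgrPdist_lt => e e0.
have := @cvg_harmonic R; move=> /cvgrPdist_lt /(_ _ e0); apply: filterS => n.
rewrite sub0r normrN ger0_norm ?invr_ge0//; exact/le_lt_trans/ub.
Qed.

(** Rounding to a grid of mesh 1/(n+1) links the topology on rows to the product sigma-algebra on
    tuples: the rounded function factors through countably many grid points and converges pointwise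
    by continuity. *)
Lemma measurable_continuous_tuple (d : nat) (F : R * 'rV[R]_d -> R) :
  continuous F ->
  measurable_fun setT (fun p : RM * d.-tuple RM => F (p.1, row_of_tuple p.2) : RM).
Proof.
move=> cF.
pose Q n (p : RM * d.-tuple RM) : int * {ffun 'I_d -> int} :=
  (Num.floor (n.+1%:R * p.1), [ffun j => Num.floor (n.+1%:R * tnth p.2 j)]).
pose G n (c : int * {ffun 'I_d -> int}) : RM :=
  F (c.1%:~R / n.+1%:R, \row_j ((c.2 j)%:~R / n.+1%:R)).
have mfloor n (k : int) : measurable [set x : RM | Num.floor (n.+1%:R * x) = k].
  have n0 : 0 < n.+1%:R :> R by [].
  rewrite (_ : mkset _ = `[(k%:~R / n.+1%:R), ((k + 1)%:~R / n.+1%:R)[%classic).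
    exact: measurable_itv.
  apply/seteqP; split => x /=; rewrite in_itv/= ler_pdivrMr// ltr_pdivlMr//.
    by rewrite [x * _]mulrC => <-; exact: floor_itv.
  by rewrite [x * _]mulrC; exact: floor_def.
apply: (@measurable_fun_cvg _ _ _ _ (fun n => G n \o Q n)) => [n|[t s] _].
  apply: measurable_fun_countable => -[k v].
  rewrite (_ : _ @^-1` _ = (fst @^-1` [set x : RM | Num.floor (n.+1%:R * x) = k])
    `&` \bigcap_(j in [set: 'I_d]) ((fun p : RM * d.-tuple RM => tnth p.2 j) @^-1`
           [set x : RM | Num.floor (n.+1%:R * x) = v j])).
    apply: measurableI.
      by rewrite -[X in measurable X]setTI; apply: measurable_fst.
    apply: fin_bigcap_measurable => // j _.
    rewrite -[X in measurable X]setTI.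
    have mj : measurable_fun setT (fun p : RM * d.-tuple RM => tnth p.2 j).
      exact: (measurableT_comp (measurable_tnth j) measurable_snd).
    exact: mj.
  apply/seteqP; split => [p [<- <-]|p [<- h]] /=.
    by split => // j _; rewrite /= ffunE.
  by congr pair; apply/ffunP => j; rewrite ffunE; exact: h.
pose Z n : R * 'rV[R]_d := (round n t, \row_j round n (tnth s j)).
have ZE : Z n @[n --> \oo] --> (t, row_of_tuple s).
  rewrite /Z; have h1 := @round_cvg t.
  have h2 : (\row_j round n (tnth s j)) @[n --> \oo] --> row_of_tuple s.
    apply: cvg_rowP => j; rewrite mxE; under eq_fun do rewrite mxE.
    exact: round_cvg.
  exact: (cvg_pair h1 h2).
have -> : (fun n => (G n \o Q n) (t, s)) = F \o Z.
  apply/funext => n; rewrite /G/= /Z /round; congr (F (_, _)).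
  by apply/rowP => j; rewrite !mxE ffunE.
exact: (cvg_comp _ _ ZE (cF _)).
Qed.

(* Each value of [g] is the integral of its derivative up to that point, hence
   at most the total variation; the constant is the length of the support. *)
Lemma integral_le_variation (g : R -> R) :
  (forall x, derivable g x 1) -> continuous ('D_1 g) ->
  (forall x, 0 <= g x) -> (forall x, 1 < `|x| -> g x = 0) ->
  (\int[lebesgue_measure]_x (g x)%:E <=
   2%:E * \int[lebesgue_measure]_x (`|'D_1 g x|)%:E)%E.
Proof.
move=> dg cg g0 gsupp.
have cgg : continuous g.
  by move=> x; apply: differentiable_continuous; apply/derivable1_diffP.
set V := (\int[lebesgue_measure]_x (`|'D_1 g x|)%:E)%E.
have mg' : measurable_fun setT (fun x => (`|'D_1 g x|)%:E : \bar R).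
  apply/measurable_EFinP/measurableT_comp => //.
  exact: continuous_measurable_fun.
have gV x : -1 <= x -> ((g x)%:E <= V)%E.
  move=> x1; have x2 : -2 < x by lra.
  (* The base point -2 is a zero of [g] and leaves an interval of positive length even for
     [x = -1]. *)
  have g2 : g (- 2) = 0 by rewrite gsupp// normrN ger0_norm; lra.
  have dgx : derivable_oo_LRcontinuous g (- 2) x.
    split=> [y _||]; first exact: dg.
    - by apply: cvg_at_right_filter; exact: cgg.
    - by apply: cvg_at_left_filter; exact: cgg.
  have := continuous_FTC2 x2 (continuous_subspaceT cg) dgx
    (fun y _ => derive1E g y).
  rewrite g2 sube0 => <-.
  have mI : measurable_fun `[-2, x] (fun y => ('D_1 g y)%:E).
    apply/measurable_EFinP; apply: measurable_funTS.
    exact: continuous_measurable_fun.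
  apply: le_trans (lee_abs _) _.
  apply: le_trans (le_abse_integral _ _ _) _ => //.
  apply: ge0_subset_integral => //.
have gE : (\int[lebesgue_measure]_x (g x)%:E =
    \int[lebesgue_measure]_(x in `[(-1)%R, 1%R]) (g x)%:E)%E.
  rewrite [RHS]integral_mkcond; apply: eq_integral => x _.
  rewrite patchE; case: ifPn => // /negP.
  rewrite inE/= in_itv/= -ler_norml => /negP; rewrite -ltNge => x1.
  by rewrite gsupp.
rewrite gE (@le_trans _ _ (\int[lebesgue_measure]_(x in `[(-1)%R, 1%R]) V)%E)//.
  apply: ge0_le_integral => //.
  - by move=> x _; rewrite lee_fin.
  - apply/measurable_EFinP; apply: measurable_funTS.
    exact: continuous_measurable_fun.
  - by move=> x /= /andP[]; rewrite bnd_simp => x1 _; exact: gV.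
clearbody V; rewrite integral_cst//=.
rewrite lebesgue_measure_itv/= lte_fin.
rewrite ifT; last lra.
by rewrite muleC -EFinD opprK.
Qed.

End measurability.

(** * Directional derivatives depend only on the restriction to a line *)

Section derive_along.
Context {R : realType} {V V' : normedModType R}.
Variables (f : V -> R) (f' : V' -> R) (a v : V) (a' v' : V').
Hypothesis ff' : forall h : R, f (h *: v + a) = f' (h *: v' + a').

Let quotient_eq : (fun h : R => h^-1 *: ((f \o shift a) (h *: v) - f a)) =
  (fun h : R => h^-1 *: ((f' \o shift a') (h *: v') - f' a')).
Proof.
have faf' : f a = f' a' by have := ff' 0; rewrite !scale0r !add0r.
by apply/funext => h; rewrite /= ff' faf'.
Qed.

Lemma eq_derive_along : 'D_v f a = 'D_v' f' a'.
Proof. by rewrite /derive quotient_eq. Qed.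

Lemma eq_derivable_along : derivable f a v = derivable f' a' v'.
Proof. by rewrite /derivable quotient_eq. Qed.

End derive_along.

(** * Lower bound for the L1 norm of the first partial derivative of the mollifier *)

Section mollifier_variation.
Context {R : realType}.
Notation RM := (measurableTypeR R).
Notation leb := (@lebesgue_measure R).

Definition cube (d : nat) : set (d.-tuple RM) :=
  \bigcap_(i in [set: 'I_d]) (fun s : d.-tuple RM => tnth s i) @^-1` `[-1, 1]%classic.

Arguments cube : clear implicits.

Lemma measurable_cube d : measurable (cube d).
Proof.
apply: fin_bigcap_measurable => // i _; rewrite -[X in measurable X]setTI.
exact: measurable_tnth.
Qed.

Lemma lebesgue_cube_lty d : (lebesgue_tuple R d (cube d) < +oo)%E.
Proof.
elim: d => [|d ih]; first by rewrite /= diracE ltry.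
rewrite /= /cons_measure /pushforward.
have -> : @tcons R d @^-1` (cube d.+1) = `[-1, 1]%classic `*` cube d.
  apply/seteqP; split => [[x s] h|[x s] [/= hx h] i _]; first split => /=.
  - by have := h ord0 I; rewrite /= tnth0.
  - by move=> i _; have := h (lift ord0 i) I; rewrite /= tnthS.
  - by case: (unliftP ord0 i) => [j ->|->]; rewrite /= ?tnthS ?tnth0//; exact: h.
rewrite product_measure1E//; last exact: measurable_cube.
by rewrite lte_mul_pinfty//= lebesgue_measure_itv/=; case: ifP.
Qed.

Lemma integral_lebesgue_tupleS d (F : d.+1.-tuple RM -> \bar R) :
  measurable_fun setT F -> (forall s, 0 <= F s)%E ->
  (\int[lebesgue_tuple R d.+1]_s F s =
   \int[lebesgue_tuple R d]_s \int[leb]_x F (tcons (x, s)))%E.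
Proof.
move=> mF F0.
have mtc := @measurable_tcons R d.
rewrite [LHS](ge0_integral_pushforward mtc)//.
rewrite (fubini_tonelli2 (F \o @tcons R d))//.
  exact: measurableT_comp.
by move=> p; exact: F0.
Qed.

Variables (m : nat) (eta : R * 'rV[R]_m.+1 -> R).
Hypothesis eta_mollifier : mollifier eta.
Let e : 'rV[R]_m.+1 := delta_mx 0 0.

Lemma row_of_tcons (h x : R) (s : m.-tuple R) :
  row_of_tuple (tcons (h *: 1 + x, s)) = h *: e + row_of_tuple (tcons (x, s)).
Proof.
apply/rowP => j; rewrite !mxE /=; case: (unliftP ord0 j) => [k ->|->].
  by rewrite !tnthS mulr0 add0r.
by rewrite !tnth0.
Qed.

(** A space direction keeps [t] fixed, so the line stays in the half-space and [eta] may be replaced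
    by its smooth extension [g], also at [t = 0]. *)
Lemma halfspace_along (g : R * 'rV[R]_m.+1 -> R) t y :
  (forall t y, 0 <= t -> eta (t, y) = g (t, y)) -> 0 <= t -> forall h : R,
  (fun y => eta (t, y)) (h *: e + y) = g (h *: (0, e) + (t, y)).
Proof.
move=> etag t0 h; rewrite /= etag//; congr g; congr pair.
by rewrite /= scaler0 add0r.
Qed.

(** A derivative sees only a neighbourhood: for [t > 1] the whole slice vanishes, and otherwise the
    exterior of the ball is open. *)
Lemma derive_off_support t y : 0 <= t -> ~ (t <= 1 /\ enorm y <= 1) ->
  'D_e (fun y => eta (t, y)) y = 0.
Proof.
move=> t0 ty; have etay z : ~ (t <= 1 /\ enorm z <= 1) -> eta (t, z) = 0.
  move=> tz; apply/eqP; apply/negPn/negP => nz; apply: tz.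
  exact: mollifier_support eta_mollifier _ _ t0 nz.
have -> : 0 = 'D_e (cst (0 : R)) y by rewrite derive_cst.
apply: near_eq_derive; have [t1|t1] := leP t 1; last first.
  by apply: (@filterE _ (nbhs y)) => z; rewrite etay// => -[]; rewrite leNgt t1.
have y1 : 1 < enorm y by rewrite ltNge; apply/negP => y1; apply: ty.
have := @cvgr_gt _ _ (nbhs y) _ (@enorm R m.+1) (enorm y)
  (@enorm_continuous R m.+1 y) _ y1.
move=> /(_ (nbhs_filter y)) y_near.
have sub : [set z | 1 < enorm z] `<=` [set z | eta (t, z) = cst 0 z].
  by move=> z z1 /=; rewrite etay// => -[_]; rewrite leNgt z1.
exact: (@filterS _ (nbhs y) (nbhs_filter y) _ _ sub y_near).
Qed.

Let D : set (RM * m.+1.-tuple RM) := [set p | 0 <= p.1].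
Let D0 (p : R * 'rV[R]_m.+1) := 'D_e (fun y => eta (p.1, y)) p.2.

Let measurable_D : measurable D.
Proof.
have -> : D = fst @^-1` `[0%R, +oo[%classic.
  by apply/seteqP; split => p /=; rewrite in_itv/= andbT.
by rewrite -[X in measurable X]setTI; exact: measurable_fst.
Qed.

Lemma measurable_halfspace (k k' : R * 'rV[R]_m.+1 -> R) :
  continuous k' -> (forall t y, 0 <= t -> k (t, y) = k' (t, y)) ->
  measurable_fun D (fun p : RM * m.+1.-tuple RM => k (p.1, row_of_tuple p.2) : RM).
Proof.
move=> ck kk'; apply: (eq_measurable_fun
    (fun p : RM * m.+1.-tuple RM => k' (p.1, row_of_tuple p.2) : RM)).
  by move=> p; rewrite inE => p0; rewrite kk'.
exact: (measurable_funTS (measurable_continuous_tuple ck)).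
Qed.

(* Fubini isolates the first space coordinate, along which the variation bounds
   the integral. *)
Lemma integral_le_gradient t : 0 <= t ->
  (\int[lebesgue_tuple R m.+1]_s (eta (t, row_of_tuple s))%:E <=
   2%:E * \int[lebesgue_tuple R m.+1]_s (`|D0 (t, row_of_tuple s)|)%:E)%E.
Proof.
move=> t0; have [g sg etag] := mollifier_smooth eta_mollifier.
have [dg cg] := sg 1%N (0, e).
have D0E y : D0 (t, y) = 'D_(0, e) g (t, y).
  by rewrite /D0/=; exact/eq_derive_along/halfspace_along.
have mt (k : R * 'rV[R]_m.+1 -> R) : continuous k ->
    measurable_fun setT (fun s : m.+1.-tuple RM => k (t, row_of_tuple s) : RM).
  move=> /measurable_continuous_tuple mk.
  exact: (measurableT_comp mk
    (measurable_fun_pair (measurable_cst t) (@measurable_id _ _ setT))).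
have meta : measurable_fun setT
    (fun s : m.+1.-tuple RM => (eta (t, row_of_tuple s))%:E).
  apply/measurable_EFinP; under eq_fun do rewrite etag//.
  exact: mt (sg 0%N).
have mD0 : measurable_fun setT
    (fun s : m.+1.-tuple RM => (`|D0 (t, row_of_tuple s)|)%:E).
  apply/measurable_EFinP/measurableT_comp => //; under eq_fun do rewrite D0E.
  exact: mt cg.
have mG (k : m.+1.-tuple RM -> \bar R) : measurable_fun setT k ->
    (forall s, 0 <= k s)%E -> measurable_fun setT
    (fun s : m.-tuple RM => \int[leb]_x k (tcons (x, s)))%E.
  move=> mk k0; apply: (measurable_fun_fubini_tonelli_G (k \o @tcons R m)) => //.
    exact: measurableT_comp (@measurable_tcons R m).
  by move=> p; exact: k0.
have eta0 s : (0 <= (eta (t, row_of_tuple s))%:E)%E.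
  by rewrite lee_fin (mollifier_ge0 eta_mollifier).
have absD0 s : (0 <= (`|D0 (t, row_of_tuple s)|)%:E)%E by [].
rewrite !integral_lebesgue_tupleS// -ge0_integralZl//; last 2 first.
- exact: (mG _ mD0 absD0).
- by move=> s _; exact: integral_ge0.
apply: ge0_le_integral => //.
- by move=> s _; apply: integral_ge0.
- exact: (mG _ meta eta0).
- by apply: measurable_funeM; exact: (mG _ mD0 absD0).
move=> s _.
have along x h : eta (t, row_of_tuple (tcons (h *: 1 + x, s))) =
    g (h *: (0, e) + (t, row_of_tuple (tcons (x, s)))).
  by rewrite -(halfspace_along _ etag t0) row_of_tcons.
have D0x x : 'D_1 (fun x => eta (t, row_of_tuple (tcons (x, s)))) x =
    'D_(0, e) g (t, row_of_tuple (tcons (x, s))).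
  exact: eq_derive_along (along x).
under [in leRHS]eq_integral do rewrite D0E -D0x.
apply: (@integral_le_variation R (fun x => eta (t, row_of_tuple (tcons (x, s))))).
- by move=> x; rewrite (eq_derivable_along (along x)).
- have -> : 'D_1 (fun x => eta (t, row_of_tuple (tcons (x, s)))) =
      ('D_(0, e) g) \o (fun x => (t, row_of_tuple (tcons (x, s)))).
    exact/funext/D0x.
  move=> x; apply: continuous_comp; last exact: cg.
  have cx : row_of_tuple (tcons (y, s)) @[y --> x] --> row_of_tuple (tcons (x, s)).
    apply: cvg_rowP => j; rewrite mxE; under eq_fun do rewrite mxE.
    case: (unliftP ord0 j) => [k ->|->]; rewrite /= ?tnthS ?tnth0.
      by under eq_fun do rewrite tnthS; exact: cvg_cst.
    by under eq_fun do rewrite tnth0; exact: cvg_id.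
  exact: cvg_pair (cvg_cst t) cx.
- by move=> x; rewrite (mollifier_ge0 eta_mollifier).
- move=> x x1; apply/eqP; apply/negPn/negP => nz.
  have [_] := mollifier_support eta_mollifier t0 nz.
  rewrite leNgt => /negP; apply; apply: lt_le_trans x1 _.
  by have := le_coord_enorm (row_of_tuple (tcons (x, s))) ord0; rewrite mxE tnth0.
Qed.

Lemma gradient_extension : exists2 k : R * 'rV[R]_m.+1 -> R, continuous k &
  forall t y, 0 <= t -> D0 (t, y) = k (t, y).
Proof.
have [g sg etag] := mollifier_smooth eta_mollifier.
exists ('D_(0, e) g); first by have [] := sg 1%N (0, e).
by move=> t y t0; exact/eq_derive_along/halfspace_along.
Qed.

Lemma gradient_bounded : exists K : R, forall t y, 0 <= t -> `|D0 (t, y)| <= K.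
Proof.
have [k ck D0k] := gradient_extension.
have cA : compact ((`[0, 1]%classic : set R) `*` [set y : 'rV[R]_m.+1 | enorm y <= 1]).
  by apply: compact_setX; [exact: segment_compact|exact: compact_eball].
have [||[u v] _ uvmax] := compact_EVT_max _ cA
    (f := fun p => `|k p|).
- by exists (0, 0); split => /=; rewrite ?in_itv/= ?lexx ?enorm0 ler01.
- apply: continuous_subspaceT => p; apply: (@continuous_comp _ _ _ k).
    exact: ck.
  exact: norm_continuous.
exists `|k (u, v)| => t y t0.
have [ty|/(derive_off_support t0)] := pselect (t <= 1 /\ enorm y <= 1).
  rewrite D0k//; apply: uvmax; rewrite inE; split => /=; last exact: ty.2.
  by rewrite in_itv/= t0 ty.1.
by rewrite /D0/= => ->; rewrite normr0.
Qed.

(** The integrand is bounded and vanishes off a box of finite measure. Finiteness matters because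
    [integral_halfspace] is real-valued, with [fine] sending +oo to 0. *)
Lemma integral_gradient_lty :
  (\int[(leb \x lebesgue_tuple R m.+1)%E]_(p in D)
     (`|D0 (p.1, row_of_tuple p.2)|)%:E < +oo)%E.
Proof.
have [k ck D0k] := gradient_extension.
have [K D0K] := gradient_bounded.
pose S : set (RM * m.+1.-tuple RM) := `[0, 1]%classic `*` cube m.+1.
have mS : measurable S by apply: measurableX => //; exact: measurable_cube.
have SD : S `<=` D by move=> [t s] [/=]; rewrite in_itv/= => /andP[].
have -> : (\int[(leb \x lebesgue_tuple R m.+1)%E]_(p in D)
     (`|D0 (p.1, row_of_tuple p.2)|)%:E =
  \int[(leb \x lebesgue_tuple R m.+1)%E]_(p in S)
     (`|D0 (p.1, row_of_tuple p.2)|)%:E)%E.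
  rewrite integral_mkcond [RHS]integral_mkcond.
  apply: eq_integral => -[t s] _; rewrite !patchE.
  have [St|St] := boolP ((t, s) \in S).
    by rewrite mem_set//; apply: SD; rewrite inE in St.
  case: ifPn => //; rewrite inE /D /= => t0.
  have [ty|/(derive_off_support t0)] := pselect (t <= 1 /\ enorm (row_of_tuple s) <= 1).
    case/negP: St; rewrite inE; split; first by rewrite /= in_itv/= t0 ty.1.
    move=> i _ /=; rewrite in_itv/= -ler_norml (le_trans _ ty.2)//.
    by have := le_coord_enorm (row_of_tuple s) i; rewrite mxE.
  by rewrite /D0/= => ->; rewrite normr0.
apply: (@le_lt_trans _ _ (\int[(leb \x lebesgue_tuple R m.+1)%E]_(p in S) K%:E)%E).
  apply: ge0_le_integral => //.
  - apply: (measurable_funS measurable_D SD); apply/measurable_EFinP.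
    apply: measurableT_comp => //; exact: (measurable_halfspace (k := D0) ck).
  - by move=> [t s] /SD t0; rewrite lee_fin; exact: D0K.
rewrite integral_cst//= product_measure1E//; last exact: measurable_cube.
have K0 : 0 <= K by rewrite (le_trans _ (D0K 0 0 _)).
rewrite lte_mul_pinfty// lte_mul_pinfty//; last exact: lebesgue_cube_lty.
by rewrite /= lebesgue_measure_itv/=; case: ifP.
Qed.

Lemma integral_halfspace_gradient_ge :
  1 <= 2 * integral_halfspace (fun p => `|D0 p|).
Proof.
have [g sg etag] := mollifier_smooth eta_mollifier.
have [k ck D0k] := gradient_extension.
have := mollifier_integral eta_mollifier; rewrite /integral_halfspace /Rintegral.
have := integral_gradient_lty; rewrite -/D.
set I2 := (\int[_]_(p in D) (`|D0 _|)%:E)%E; set I1 := (\int[_]_(p in D) _)%E.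
(* An infinite integral would have [fine] equal to 0, so the value 1 forces finiteness. *)
move=> I2oo I1E; have {}I1E : I1 = 1%:E.
  by case: I1 I1E => [x /= ->//||] /= /eqP; rewrite eq_sym oner_eq0.
have I20 : (0 <= I2)%E by apply: integral_ge0.
have I2E : I2 = (fine I2)%:E by rewrite fineK// ge0_fin_numE.
rewrite -lee_fin EFinM -I2E -I1E /I1 /I2.
(* Extension by zero replaces the half-space by the full product, where Tonelli applies; the slices
   at negative times then vanish. *)
pose A := ((fun p : RM * m.+1.-tuple RM => (eta (p.1, row_of_tuple p.2))%:E) \_ D)%E.
pose B := ((fun p : RM * m.+1.-tuple RM => (`|D0 (p.1, row_of_tuple p.2)|)%:E) \_ D)%E.
have mA : measurable_fun setT A.
  apply/(measurable_restrict _ _ measurableT) => //; rewrite setTI.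
  apply/measurable_EFinP; exact: (measurable_halfspace (k := eta) (sg 0%N)).
have mB : measurable_fun setT B.
  apply/(measurable_restrict _ _ measurableT) => //; rewrite setTI.
  apply/measurable_EFinP/measurableT_comp => //.
  exact: (measurable_halfspace (k := D0) ck).
have A0 p : (0 <= A p)%E.
  rewrite /A patchE; case: ifPn => //; rewrite inE => pD.
  by rewrite lee_fin (mollifier_ge0 eta_mollifier).
have B0 p : (0 <= B p)%E by rewrite /B patchE; case: ifPn.
rewrite integral_mkcond [X in (_ <= _ * X)%E]integral_mkcond -/A -/B.
rewrite (fubini_tonelli1 A)// (fubini_tonelli1 B)//.
have mFA := measurable_fun_fubini_tonelli_F A mA A0.
have mFB := measurable_fun_fubini_tonelli_F B mB B0.
rewrite -ge0_integralZl//; last by move=> t _; apply: integral_ge0.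
apply: ge0_le_integral => //.
- by move=> t _; apply: integral_ge0.
- exact: measurable_funeM.
move=> t _; rewrite /fubini_F /A /B.
have [t0|t0] := leP 0 t.
  have tD s : (t, s) \in D by rewrite inE.
  under eq_integral do rewrite patchE tD/=.
  under [in leRHS]eq_integral do rewrite patchE tD/=.
  exact: integral_le_gradient.
have tD s : (t, s) \notin D by rewrite notin_setE /D/= leNgt t0.
rewrite integral0_eq.
  by rewrite mule_ge0//; apply: integral_ge0 => s _; exact: B0.
by move=> s _; rewrite patchE (negbTE (tD s)).
Qed.

End mollifier_variation.

(** * Conclusion *)

Lemma bnorm_ge0 {R : realType} {d : nat} (eta : R * 'rV[R]_d -> R) k l :
  0 <= bnorm eta k l.
Proof. exact: bigmax_ge_id. Qed.

Lemma bnorm01_ge {R : realType} {d : nat} (eta : R * 'rV[R]_d -> R) :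
  (0 < d)%N -> mollifier eta -> 1 <= 2 * bnorm eta 0 1.
Proof.
case: d eta => [//|m] eta _ eta_mollifier.
apply: (le_trans (integral_halfspace_gradient_ge eta_mollifier)).
rewrite ler_pM2l//.
(* The first unit multi-index, whose iterated derivative unfolds to the first partial derivative. *)
pose alpha : {ffun 'I_m.+1 -> 'I_2} := [ffun i => if i == ord0 then ord_max else ord0].
have alpha_lift i : alpha (lift ord0 i) = ord0 by rewrite ffunE.
have alpha0 : alpha ord0 = ord_max by rewrite ffunE.
have alpha1 : (\sum_(i < m.+1) alpha i)%N == 1%N.
  by rewrite big_ord_recl alpha0 big1// => i _; rewrite alpha_lift.
have -> : (fun p => `|'D_(delta_mx 0 0) (fun y => eta (p.1, y)) p.2|) =
    (fun p => `|dtDx 0 (fun i => nat_of_ord (alpha i)) eta p|).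
  apply/funext => p; rewrite /dtDx /Dmulti enum_ordSl /= alpha0 /=.
  congr `| 'D__ _ _ |; elim: (enum 'I_m) => [//|i s ih] /=.
  by rewrite alpha_lift /= -ih.
exact: (le_bigmax_cond _ _ alpha1).
Qed.

(** Term by term: r <= 8r; E[r|X|] is at most E[s r|X|] as s >= 1; and r/4 <= d r b_(0,1)/2 as d >=
    1 and b_(0,1) >= 1/2. The remaining terms are nonnegative. *)
Lemma crate_bounds {R : realType} {Omega : Type} {d : nat}
    (H : set (Omega -> R)) (E : (Omega -> R) -> R) (X : Omega -> 'rV[R]_d)
    (eta : R * 'rV[R]_d -> R) (r : R) :
  (0 < d)%N -> mollifier eta -> convex_expectation_space H E ->
  H (fun w => enorm (X w)) ->
  (forall c, 0 <= c -> H (fun w => c * enorm (X w) ^+ 2)) -> 0 < r ->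
  r + moment_error E X r <= crate_minus E X eta r /\
  r + moment_error E X r <= crate_plus E X eta r.
Proof.
move=> d0 eta_mollifier HE X_H X2_H r0.
rewrite /crate_minus /crate_plus /moment_error.
set s := Num.sqrt d%:R; set c := crate E X r.
have b01 := bnorm01_ge d0 eta_mollifier.
have [b11 b20] := (bnorm_ge0 eta 1 1, bnorm_ge0 eta 2 0).
have d1 : 1 <= d%:R :> R by rewrite ler1n.
have s1 : 1 <= s by rewrite -sqrtr1 ler_wsqrtr.
have sr : r <= s * r by rewrite ler_peMl// ltW.
have HX (k : R) : H (fun w => k * enorm (X w)) by exact: (ces_scale HE).
have EX0 k : 0 <= k -> 0 <= E (fun w => k * enorm (X w)).
  move=> k0; apply: (expect_ge0 HE) => // w.
  by rewrite mulr_ge0 ?enorm_ge0.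
have Es0 : 0 <= E (fun w => s * r * enorm (X w)) by apply: EX0; lra.
have c0 : 0 <= c by rewrite /c /crate; lra.
have E1 : E (fun w => r * enorm (X w)) <= E (fun w => s * r * enorm (X w)).
  exact: (expect_enorm_mono HE).
have k4 : r / 4 <= 2^-1 * d%:R * r * bnorm eta 0 1.
  have : r * 2^-1 <= (d%:R * r) * bnorm eta 0 1.
    by apply: ler_pM; nra.
  by lra.
have E2 : E (fun w => r * enorm (X w) + r / 4 * enorm (X w) ^+ 2) <=
    E (fun w => 2^-1 * d%:R * r * bnorm eta 0 1 * enorm (X w) ^+ 2 +
      s * r * enorm (X w)).
  apply: (ces_monotone HE) => [||w].
  - by apply: (ces_add HE) => //; apply: X2_H; lra.
  - by apply: (ces_add HE) => //; apply: X2_H; lra.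
  - by rewrite addrC lerD// ler_wpM2r ?enorm_ge0 ?sqr_ge0.
have E3 k : 0 <= k -> 0 <= E (fun w => (s * k * bnorm eta 1 1 + s * r) * enorm (X w)).
  move=> k0; apply: EX0; apply: addr_ge0; last lra.
  by rewrite !mulr_ge0//; lra.
have E4 k : 0 <= k -> 0 <= 2^-1 * k * bnorm eta 2 0.
  by move=> k0; rewrite !mulr_ge0.
by split; [have := E3 (c + r); have := E4 (c + r)|
  have := E3 (2 * c + r); have := E4 (2 * c + r)]; lra.
Qed.

Unset Implicit Arguments.

Theorem theorem4p5 (R : realType) (d : nat) (d_gt0 : (0 < d)%N)
    (eta : R * 'rV[R]_d -> R) (eta_mollifier : mollifier eta)
    (Omega : Type) (H : set (Omega -> R)) (E : (Omega -> R) -> R)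
    (HE : convex_expectation_space H E)
    (xi : nat -> Omega -> 'rV[R]_d)
    (xi_H : forall (n : nat) (i : 'I_d), H (fun w => xi n w 0 i))
    (xi_iid : iid H E xi)
    (tail_H : forall c : R, 0 <= c ->
       H (fun w => Num.max (enorm (xi 0%N w) - c) 0))
    (tail_cvg :
       E (fun w => Num.max (enorm (xi 0%N w) - c) 0) @[c --> +oo] --> (0 : R))
    (* E[c |xi_1|^2] < +oo: as E is real-valued, this is membership in H *)
    (moment2_H : forall c : R, 0 <= c ->
       H (fun w => c * enorm (xi 0%N w) ^+ 2))
    (r : R) (r_ge1 : 1 <= r) (f : 'rV[R]_d -> R) (f_Lipb : Lipb r f)
    (n : nat) (n_gt0 : (0 < n)%N) :
  let deviation : \bar R :=
    ((n%:R^-1 * E (fun w => n%:R * f (n%:R^-1 *: \sum_(i < n) xi i w)))%:E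
     - Ezeta E (xi 0%N) f)%E in
  ((- (crate_minus E (xi 0%N) eta r / Num.sqrt n%:R))%:E <= deviation)%E /\
  (deviation <= (crate_plus E (xi 0%N) eta r / Num.sqrt n%:R)%:E)%E.
Proof.
have r0 : 0 < r by lra.
have X_H := xi_H 0%N.
have enormX_H : H (fun w => enorm (xi 0%N w)).
  (* At c = 0 the tail function is the norm itself. *)
  have := tail_H 0 (lexx 0); congr H; apply/funext => w.
  by rewrite subr0 max_l// enorm_ge0.
have n0 : 0 < n%:R :> R by rewrite ltr0n.
pose l := (Num.sqrt n%:R : R)^-1.
have l0 : 0 < l by rewrite invr_gt0 sqrtr_gt0.
have sn1 : 1 <= Num.sqrt n%:R :> R.
  by rewrite -[leLHS]sqrtr1 ler_wsqrtr// ler1n.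
have l1 : l <= 1 by rewrite invf_le1 ?sqrtr_gt0.
have al : n%:R^-1 = l ^+ 2 by rewrite exprVn sqr_sqrtr// ltW.
pose B := moment_error E (xi 0%N) r.
pose S := scheme E (xi 0%N) n%:R f n 0.
have SE : n%:R^-1 * E (fun w => n%:R * f (n%:R^-1 *: \sum_(i < n) xi i w)) = S.
  have := expect_scheme_sum HE xi_H xi_iid n0 f_Lipb n.-1 0.
  by rewrite add0n prednK//= => ->; rewrite mulKf ?gt_eqF.
have eps0 : 0 < 2 * l / r by rewrite divr_gt0// mulr_gt0.
have epsE : 2 * l / r / 2 * r ^+ 2 = l * r by field; rewrite gt_eqF.
have nn1 : n%:R * n%:R^-1 = 1 :> R by rewrite divff ?gt_eqF.
have hopf0 := hopf00 HE X_H enormX_H (ltW r0) (ltW eps0).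
have phi_ge0 y : (0 <= phi E (xi 0%N) y)%E.
  apply: ereal_sup_ubound; exists 0 => //; rewrite dotv0r.
  by rewrite -[E _]/(cumulant E (xi 0%N) 0) (cumulant0 HE) subr0.
have lower y : ((f y)%:E - phi E (xi 0%N) y <= (S + l * (r + B))%:E)%E.
  have := phi_ge0 y; case phiE : (phi E (xi 0%N) y) => [p||] // _; last exact: leNye.
  rewrite -EFinB lee_fin.
  have py z : dotv y z - cumulant E (xi 0%N) z <= p.
    by rewrite -lee_fin -phiE; apply: ereal_sup_ubound; exists z.
  have := scheme_ge HE X_H n0 r0 f_Lipb enormX_H (moment2_H) l0 al n 0 py.
  rewrite nn1 subrr scale0r subr0 hopf0 epsE -/S -/B; lra.
(* Stated for every real upper bound [M], so that it also serves to exclude [Ezeta = -oo]. *)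
have upper M : (forall y, ((f y)%:E - phi E (xi 0%N) y <= M%:E)%E) ->
    S <= M + l * (r + B).
  move=> fM.
  (* Passing from the unpenalised supremum to [hopf] costs at most eps/2 r^2 = l r, which is
     absorbed in the constant. *)
  have fhopf x : f x <= M + l * r + hopf E (xi 0%N) r (2 * l / r) 1 x.
    apply/ler_addgt0Pr => e e0.
    have [z zr fx] := lipschitz_le_hopf HE X_H enormX_H x r0 e0 f_Lipb.1 fM.
    have := hopf_ge HE X_H enormX_H (2 * l / r) 1 x zr.
    have : 2 * l / r / 2 * dotv z z <= l * r.
      rewrite -epsE -sqr_enorm ler_pM2l; last by rewrite [ltRHS]mulrC mulr_gt0.
      by rewrite ler_pXn2r// nnegrE ?enorm_ge0 ?(ltW r0).
    by rewrite /hopf_arg mul1r; lra.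
  have := @scheme_le _ _ _ _ _ HE _ X_H _ _ _ n0 r0 f_Lipb enormX_H moment2_H
    _ l0 l1 al (M + l * r) n 0.
  rewrite nn1 subrr hopf0 => /(_ (lexx _) fhopf); rewrite -/S -/B; lra.
have [cm cp] := crate_bounds d_gt0 eta_mollifier HE enormX_H moment2_H r0.
have {}cm : l * (r + B) <= crate_minus E (xi 0%N) eta r / Num.sqrt n%:R.
  by rewrite mulrC ler_pM2r.
have {}cp : l * (r + B) <= crate_plus E (xi 0%N) eta r / Num.sqrt n%:R.
  by rewrite mulrC ler_pM2r.
move=> deviation; rewrite /deviation SE {deviation}.
have Zle : (Ezeta E (xi 0%N) f <= (S + l * (r + B))%:E)%E.
  by apply: ge_ereal_sup => _ [y _ <-]; exact: lower.
have Zge y : ((f y)%:E - phi E (xi 0%N) y <= Ezeta E (xi 0%N) f)%E.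
  by apply: ereal_sup_ubound; exists y.
case ZE : (Ezeta E (xi 0%N) f) Zle Zge => [Z||]// Zle Zge.
  rewrite lee_fin in Zle; have := upper Z Zge.
  by rewrite -EFinB !lee_fin => SZ; split; lra.
(* If [Ezeta] were -oo, every real would be an upper bound; this choice of [M] then yields S <= S -
   1. *)
have SM : S <= S - l * (r + B) - 1 + l * (r + B).
  by apply: upper => y; apply: (le_trans (Zge y)); exact: leNye.
by exfalso; move: SM; lra.
Qed.
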